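(* Let $m,r,t\geq 2$ be integers, let $C_{m,r}$ be a cycle poset, and let $S$ be the polynomial ring over a field $k$ whose variables are the elements of $C_{m,r}$. Then $S/I_t(C_{m,r})$ is sequentially Cohen–Macaulay if one of the following conditions holds: (i) $C_{m,r}$ is not a graded poset and $t>\min(r,m)$; (ii) $C_{m,r}$ is a graded poset and $t=m$. Moreover, in case (i), $S/I_t(C_{m,r})$ is Cohen–Macaulay if and only if $t=\max(r,m)$ or $2t=\max(r,m)$. In case (ii), $S/I_t(C_{m,r})$ is Cohen–Macaulay if and only if $t=2$, that is, $C_{m,r}$ is the two-element chain poset $\{x_{i_1}<x_{i_2}\}$.
   Context: The cycle poset $C_{m,r}$ is the poset having exactly two maximal saturated chains $x_{i_1}<\cdots<x_{i_m}$ and $x_{j_1}<\cdots<x_{j_r}$, with $m$ and $r$ elements respectively, where $x_{i_1}=x_{j_1}$, $x_{i_m}=x_{j_r}$ and the two chains have no other elements in common; its cover relations are exactly the consecutive relations in these two chains, so that its Hasse diagram is a cycle as an undirected graph (in the degenerate case $m=r=2$ the two chains coincide and $C_{2,2}$ is the two-element chain). $C_{m,r}$ is graded if and only if $m=r$. A path of length $t$ in a poset $P$ is a saturated chain of $t$ elements (each element covers the previous one). The path ideal $I_t(P)\subseteq S$ is generated by the monomials $x_{l_1}\cdots x_{l_t}$ where $x_{l_1},\ldots,x_{l_t}$ runs over the paths of length $t$ in $P$.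
   Formalization: In case (i) the Cohen–Macaulay criterion is stated only for t ≤ max(r,m): for t > max(r,m) there are no paths of length t, so I_t = 0 and S/I_t = S is Cohen–Macaulay although t ≠ max(r,m) and 2t ≠ max(r,m). *)

(* Defs.v *)
From mathcomp Require Import all_boot all_order all_algebra.
From mathcomp Require Import classical_sets.
From mathcomp Require Export mpoly.

Set Implicit Arguments.
Unset Strict Implicit.
Unset Printing Implicit Defensive.

Import Order.TTheory GRing.Theory.

Local Open Scope classical_set_scope.
Local Open Scope ring_scope.

(* Ideals of R are subsets (the whole ring is an ideal), so that they can be
   generated by arbitrary sets.  A pair of ideals B `<=` A stands for the
   R-module A / B; all module invariants below are those of A / B. *)
Section CommutativeAlgebra.
Variable R : comNzRingType.
Implicit Types (I A B P M : set R) (s : seq R) (d : nat).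

Definition is_ideal I : Prop :=
  [/\ I 0, forall x y, I x -> I y -> I (x + y) & forall a x, I x -> I (a * x)].

Definition ideal_generated (G : set R) : set R := smallest is_ideal G.

Definition prime_ideal P : Prop :=
  [/\ is_ideal P, ~ P 1 & forall x y, P (x * y) -> P x \/ P y].

Definition annihilator A B : set R := [set r | forall a, A a -> B (r * a)].

(* p 0 `<` p 1 `<` ... `<` p d, all containing I *)
Definition prime_chain_over I d (p : nat -> set R) : Prop :=
  (forall i, (i <= d)%N -> prime_ideal (p i) /\ I `<=` p i) /\
  (forall i, (i < d)%N -> p i `<` p i.+1).

(* The dimension of a module is the Krull dimension of R / Ann.  The zero
   module has no dimension in the sense of this relation. *)
Definition has_dim A B d : Prop :=
  (exists p, prime_chain_over (annihilator A B) d p) /\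
  (forall e p, prime_chain_over (annihilator A B) e p -> (e <= d)%N).

(* B + (s) A, so that A / sub_mul A B s is (A / B) / (s)(A / B) *)
Definition sub_mul A B s : set R :=
  ideal_generated (B `|` [set x | exists2 f, f \in s & exists2 a, A a & x = f * a]).

(* s is an (A / B)-regular sequence of elements of M *)
Definition regular_sequence M A B s : Prop :=
  [/\ forall f, f \in s -> M f,
      forall i, (i < size s)%N ->
        forall a, A a -> sub_mul A B (take i s) (s`_i * a) ->
                  sub_mul A B (take i s) a
    & exists2 a, A a & ~ sub_mul A B s a].

Definition has_depth M A B d : Prop :=
  (exists2 s, size s = d & regular_sequence M A B s) /\
  (forall s, regular_sequence M A B s -> (size s <= d)%N).

End CommutativeAlgebra.

Section GradedModules.
Variables (k : fieldType) (n : nat).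
Implicit Types (A B I : set {mpoly k[n]}).

Definition irrelevant_ideal : set {mpoly k[n]} := [set p | p@_0%MM = 0].

Definition graded_ideal I : Prop :=
  is_ideal I /\ forall d p, I p -> I (pihomog mdeg d p).

(* For a finitely generated graded module the depth is taken with respect to
   the irrelevant maximal ideal. *)
Definition CM_module A B : Prop :=
  exists2 d, has_dim A B d & has_depth irrelevant_ideal A B d.

Definition cohen_macaulay I : Prop := CM_module setT I.

(* A filtration 0 = M_0 < M_1 < ... < M_l = S / I by graded submodules, with
   M_i = F i / I, such that every quotient M_(i+1) / M_i = F (i+1) / F i is
   Cohen-Macaulay and the dimensions of these quotients strictly increase. *)
Definition sequentially_CM I : Prop :=
  exists (l : nat) (F : nat -> set {mpoly k[n]}) (dm : nat -> nat),
    [/\ F 0%N = I /\ F l = setT,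
        forall i, (i <= l)%N -> graded_ideal (F i),
        forall i, (i < l)%N -> F i `<` F i.+1,
        forall i, (i < l)%N -> CM_module (F i.+1) (F i) /\
                               has_dim (F i.+1) (F i) (dm i)
      & forall i, (i.+1 < l)%N -> (dm i < dm i.+1)%N].

End GradedModules.

Section Posets.
Variables (disp : Order.disp_t) (P : finPOrderType disp).
Implicit Types (x y : P) (c : seq P).

Definition covers : rel P :=
  [rel x y | (x < y)%O && [forall z : P, ~~ ((x < z)%O && (z < y)%O)]].

Definition saturated_chain c : Prop := sorted covers c.

Definition maximal_saturated_chain c : Prop :=
  saturated_chain c /\
  forall c', saturated_chain c' -> {subset c <= c'} -> c' = c.

Definition graded_poset : Prop :=
  forall c c', maximal_saturated_chain c -> maximal_saturated_chain c' ->
    size c = size c'.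

(* P is a cycle poset C_(m,r), for m, r >= 2: c1 and c2 are its maximal
   saturated chains, with common ends a, b and disjoint interiors s1, s2. *)
Definition cycle_poset (m r : nat) : Prop :=
  exists (a b : P) (s1 s2 : seq P),
    let c1 := a :: rcons s1 b in
    let c2 := a :: rcons s2 b in
    [/\ size c1 = m /\ size c2 = r,
        forall c, maximal_saturated_chain c <-> c = c1 \/ c = c2,
        forall x, ~ (x \in s1 /\ x \in s2)
      & forall x y, covers x y <-> infix [:: x; y] c1 \/ infix [:: x; y] c2].

Definition two_element_chain : Prop :=
  exists a b : P, (a < b)%O /\ forall x, x = a \/ x = b.

Definition path_monomial (k : fieldType) c : {mpoly k[#|P|]} :=
  \prod_(x <- c) 'X_(enum_rank x).

Definition path_ideal (k : fieldType) (t : nat) : set {mpoly k[#|P|]} :=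
  ideal_generated
    [set u | exists c, [/\ saturated_chain c, size c = t
                         & u = path_monomial k c]].

End Posets.

(* Main.v *)
(* A path longer than the shorter maximal chain lies in the longer one, so in
   case (i) the path ideal is that of a chain of N = max(m, r) elements, and in
   case (ii) it is generated by the two maximal chains.  Identify a squarefree
   monomial ideal with an up-closed family W of sets of variables.  Adding to W
   an interval of sets s with R <= s and s disjoint from C adds to the ideal a
   copy of S / P_C, where P_C is generated by the variables in C.  A face s (a
   set outside W) is labelled by a minimal cover C disjoint from s: for the
   chain, by the greedy cover, which hits each unhit path as late as possible.
   The labels partition the faces into intervals, and ordering them by
   decreasing #|C| filters S / I by quotients built from copies of S / P_C with
   #|C| = n - d.  On all of these e_d, ..., e_1 (elementary symmetric
   polynomials, over any field) is a regular sequence, and their dimension is d.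
   Conversely depth S/I <= dim S/P_C for every minimal cover C, so two minimal
   covers of different sizes exclude Cohen-Macaulayness. *)
Require Import Defs.
From mathcomp Require Import all_boot all_order all_algebra.
From mathcomp Require Import boolp classical_sets.
From mathcomp.algebra_tactics Require Import ring.
From mathcomp.zify Require Import zify.
Set Implicit Arguments.
Unset Strict Implicit.
Unset Printing Implicit Defensive.
Import Order.TTheory GRing.Theory.
Local Open Scope classical_set_scope.
Local Open Scope ring_scope.
(* classical_sets overloads this notation *)
Local Notation "[ 'disjoint' A & B ]" := (disjoint (mem A) (mem B)) : ring_scope.

(** * Regular sequences and chains of primes *)

(** Regularity is glued along an extension only for one and the same sequence, so all the copies of
    S / P_C in a quotient must share theirs although the C differ; hence a sequence symmetric in the
    variables. Its order matters: modulo P_C, with d variables outside C, [e_d] is a single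
    monomial, and dividing by it leaves pieces S / P_(C + i) with d - 1 variables, for which
    [e_(d-1)] comes next.

    Depth is compared with dimension through chains of primes. A regular sequence produces a chain
    of its own length over the annihilator, and the same construction over a colon ideal (B : a)
    gives depth <= dim R / (B : a) without associated primes. Chains over P_C are bounded by
    counting: a chain of length e gives K^e linearly independent classes of degree O(K), while S /
    P_C has only O(K^d) monomials to carry them. *)

Section RegularSequences.
Variable R : comNzRingType.
Implicit Types (A B J M N : set R) (s : seq R) (f g a b r x y : R).

Definition adjoin B f A : set R :=
  [set x | exists2 b, B b & exists2 a, A a & x = b + f * a].

Definition colon B g : set R := [set r | B (r * g)].

(** Regularity without nondegeneracy, by recursion on the head. It holds for the zero module and so
    can be glued along extensions; nondegeneracy is established separately. *)
Fixpoint weakly_regular A B s : Prop :=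
  if s is f :: s' then
    (forall a, A a -> B (f * a) -> B a) /\ weakly_regular A (adjoin B f A) s'
  else True.

Fixpoint quotient_by A B s : set R :=
  if s is f :: s' then quotient_by A (adjoin B f A) s' else B.

Lemma ideal0 B : is_ideal B -> B 0. Proof. by case. Qed.
Lemma idealD B x y : is_ideal B -> B x -> B y -> B (x + y).
Proof. by case=> _ + _; apply. Qed.
Lemma idealM B a x : is_ideal B -> B x -> B (a * x).
Proof. by case=> _ _; apply. Qed.
Lemma idealMr B a x : is_ideal B -> B x -> B (x * a).
Proof. by move=> hB hx; rewrite mulrC; apply: idealM. Qed.
Lemma idealN B x : is_ideal B -> B x -> B (- x).
Proof. by move=> hB hx; rewrite -mulN1r; apply: idealM. Qed.
Lemma idealB B x y : is_ideal B -> B x -> B y -> B (x - y).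
Proof. by move=> hB hx hy; apply: idealD => //; apply: idealN. Qed.
Lemma ideal_sum B (I : eqType) (r : seq I) (F : I -> R) :
  is_ideal B -> (forall i, i \in r -> B (F i)) -> B (\sum_(i <- r) F i).
Proof.
move=> hB; elim: r => [|i r IH] h; first by rewrite big_nil; apply: ideal0.
rewrite big_cons; apply: idealD => //; first by apply: h; rewrite inE eqxx.
by apply: IH => j hj; apply: h; rewrite inE hj orbT.
Qed.

Lemma setT_ideal : is_ideal (setT : set R). Proof. by []. Qed.

Lemma adjoin_ideal B f A : is_ideal B -> is_ideal A -> is_ideal (adjoin B f A).
Proof.
move=> hB hA; split.
- by exists 0; [exact: ideal0 | exists 0; [exact: ideal0 | rewrite mulr0 addr0]].
- move=> _ _ [b hb [a ha ->]] [b' hb' [a' ha' ->]].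
  exists (b + b'); first exact: idealD.
  by exists (a + a'); [exact: idealD | ring].
- move=> c _ [b hb [a ha ->]]; exists (c * b); first exact: idealM.
  by exists (c * a); [exact: idealM | ring].
Qed.

Lemma sub_adjoin B f A : is_ideal A -> B `<=` adjoin B f A.
Proof.
move=> hA b hb; exists b => //; exists 0; first exact: ideal0.
by rewrite mulr0 addr0.
Qed.

Lemma adjoin_sub B f A J :
  is_ideal J -> B `<=` J -> (forall a, A a -> J (f * a)) -> adjoin B f A `<=` J.
Proof.
move=> hJ hB hA _ [b hb [a ha ->]].
by apply: idealD => //; [exact: hB | exact: hA].
Qed.

Lemma mem_adjoin B f A a : is_ideal B -> A a -> adjoin B f A (f * a).
Proof.
by move=> hB ha; exists 0; [exact: ideal0 | exists a; rewrite ?add0r].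
Qed.

Lemma mem_adjoinT B f : is_ideal B -> adjoin B f setT f.
Proof. by move=> hB; rewrite -[X in adjoin _ _ _ X]mulr1; apply: mem_adjoin. Qed.

Lemma adjoinAC A B f g A' : adjoin (adjoin B f A) g A' = adjoin (adjoin B g A') f A.
Proof.
suff sub f1 A1 g1 A2 : adjoin (adjoin B f1 A1) g1 A2 `<=` adjoin (adjoin B g1 A2) f1 A1.
  by apply/seteqP; split; apply: sub.
move=> _ [_ [b hb [a ha ->]] [a' ha' ->]]; exists (b + g1 * a').
  by exists b => //; exists a'.
by exists a => //; ring.
Qed.

Lemma colon_ideal B g : is_ideal B -> is_ideal (colon B g).
Proof.
move=> hB; split; rewrite /colon /=.
- by rewrite mul0r; apply: ideal0.
- by move=> x y hx hy; rewrite mulrDl; apply: idealD.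
- by move=> a x hx; rewrite -mulrA; apply: idealM.
Qed.

Lemma annihilator_ideal A B : is_ideal B -> is_ideal (annihilator A B).
Proof.
move=> hB; split.
- by move=> a _; rewrite mul0r; apply: ideal0.
- by move=> x y hx hy a ha; rewrite mulrDl; apply: idealD => //; [exact: (hx a ha)|exact: (hy a ha)].
- by move=> c x hx a ha; rewrite -mulrA; apply: idealM => //; exact: (hx a ha).
Qed.

Lemma ideal_generated_ideal (G : set R) : is_ideal (ideal_generated G).
Proof.
split.
- by move=> A [hA _]; apply: ideal0.
- by move=> x y hx hy A hA; apply: idealD; [by case: hA|exact: (hx A hA)|exact: (hy A hA)].
- by move=> a x hx A hA; apply: idealM; [by case: hA|exact: (hx A hA)].
Qed.

Lemma ideal_generated_sub (G J : set R) :
  is_ideal J -> G `<=` J -> ideal_generated G `<=` J.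
Proof. by move=> hJ hG; apply: smallest_sub. Qed.

Lemma sub_mulE A B s : is_ideal A -> is_ideal B -> sub_mul A B s = quotient_by A B s.
Proof.
move=> hA; elim: s B => [|f s IH] B hB /=.
  apply/seteqP; split.
    by apply: ideal_generated_sub => // x [//|[? ]]; rewrite in_nil.
  by move=> x hx; apply: sub_gen_smallest; left.
rewrite -IH; last exact: adjoin_ideal.
have hgen : is_ideal (sub_mul A B (f :: s)) by exact: ideal_generated_ideal.
have hgen' : is_ideal (sub_mul A (adjoin B f A) s) by exact: ideal_generated_ideal.
apply/seteqP; split; apply: ideal_generated_sub => // x.
  case=> [hx|[g]].
    by apply: sub_gen_smallest; left; apply: sub_adjoin.
  rewrite inE => /orP[/eqP-> [a ha ->]|hg hx].
    by apply: sub_gen_smallest; left; apply: mem_adjoin.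
  by apply: sub_gen_smallest; right; exists g.
case=> [|[g hg hx]]; last first.
  by apply: sub_gen_smallest; right; exists g => //; rewrite inE hg orbT.
apply: adjoin_sub => // [b hb|a ha]; apply: sub_gen_smallest; first by left.
by right; exists f; rewrite ?inE ?eqxx //; exists a.
Qed.

Lemma quotient_by_sub A B s J : is_ideal J -> B `<=` J ->
  (forall f a, f \in s -> A a -> J (f * a)) -> quotient_by A B s `<=` J.
Proof.
move=> hJ; elim: s B => [//|f s IH] B hB h /=; apply: IH => [|g a hg].
  by apply: adjoin_sub => // a; apply: h; rewrite inE eqxx.
by apply: h; rewrite inE hg orbT.
Qed.

Lemma weakly_regular_refl A s : is_ideal A -> weakly_regular A A s.
Proof.
suff main B : is_ideal A -> A `<=` B -> weakly_regular A B s by move=> hA; apply: main.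
elim: s B => [|f s IH] B hA hAB //=; split; first by move=> a /hAB.
by apply: IH => //; apply: (classical_sets.subset_trans hAB); apply: sub_adjoin.
Qed.

Lemma regular_sequenceE M A B s : is_ideal A -> is_ideal B ->
  regular_sequence M A B s <->
  [/\ forall f, f \in s -> M f, weakly_regular A B s
    & exists2 a, A a & ~ quotient_by A B s a].
Proof.
move=> hA hB; rewrite /regular_sequence sub_mulE //.
suff -> : (forall i, (i < size s)%N -> forall a, A a ->
    sub_mul A B (take i s) (s`_i * a) -> sub_mul A B (take i s) a) =
  weakly_regular A B s by [].
apply/propext; elim: s B hB => [|f s IH] B hB //=.
have hB' : is_ideal (adjoin B f A) by exact: adjoin_ideal.
rewrite -(IH _ hB'); split.
  move=> h; split.
    by move=> a ha; have := h 0%N isT a ha; rewrite /= sub_mulE.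
  move=> i hi a ha; have := h i.+1 hi a ha.
  by rewrite /= !sub_mulE.
case=> h0 h1 [|i] hi a ha; first by rewrite /= sub_mulE //=; apply: h0.
by have := h1 i hi a ha; rewrite !sub_mulE.
Qed.

(* This is the extension of the cyclic module (B + (g)) / B, isomorphic to
   R / (B : g), by A / (B + (g)). *)
Lemma weakly_regular_extension A B g s : is_ideal A -> is_ideal B ->
  B `<=` A -> A g ->
  weakly_regular setT (colon B g) s -> weakly_regular A (adjoin B g setT) s ->
  weakly_regular A B s.
Proof.
move=> hA; elim: s B => [|f s IH] B hB hBA hg //= [h1 h2] [h3 h4].
have hBf : is_ideal (adjoin B f A) by exact: adjoin_ideal.
have hreg a : A a -> B (f * a) -> B a.
  move=> ha hfa; have [b hb [u _ ea]] := h3 a ha (sub_adjoin _ setT_ideal hfa).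
  rewrite ea; apply: idealD => //; rewrite mulrC; apply: h1 => //.
  rewrite /colon /=.
  have -> : f * u * g = f * a - f * b by rewrite ea; ring.
  by apply: idealB => //; apply: idealM.
split=> //; apply: IH => //; last by rewrite adjoinAC.
  by apply: adjoin_sub => // a ha; apply: idealM.
(* Dividing by [f] keeps the extension exact: [f] is regular on the upper piece [A / (B + (g))], so
   if [r g = b + f a] then [a] already lies in [B + (g)], and [r] can be corrected by a multiple of
   [f]. *)
suff -> : colon (adjoin B f A) g = adjoin (colon B g) f setT by [].
apply/seteqP; split.
  move=> r [b hb [a ha e]].
  have [|b' hb' [u _ ea]] := h3 a ha.
    exists (- b); first exact: idealN.
    by exists r => //; rewrite [g * r]mulrC e; ring.
  exists (r - f * u); last by exists u => //; ring.
  rewrite /colon /=; have -> : (r - f * u) * g = b + f * b'.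
    by rewrite mulrBl e ea; ring.
  by apply: idealD => //; apply: idealM.
move=> _ [b hb [u _ ->]]; exists (b * g) => //; exists (u * g); last by ring.
exact: idealM.
Qed.

Lemma annihilator_extension A B g r u :
  is_ideal B -> annihilator A (adjoin B g setT) r -> colon B g u ->
  annihilator A B (r * u).
Proof.
move=> hB hr hu a ha; have [b hb [c _ e]] := hr a ha.
have -> : r * u * a = u * b + c * (u * g) by rewrite mulrAC e; ring.
by apply: idealD => //; apply: idealM.
Qed.

(** * Chains of primes obtained from regular sequences in a noetherian ring *)

Definition noetherian : Prop :=
  forall Q : set (set R), (exists J, Q J) -> (forall J, Q J -> is_ideal J) ->
  exists2 J, Q J & forall J', Q J' -> J `<=` J' -> J' `<=` J.

Hypothesis noethR : noetherian.

(** An ideal maximal among those disjoint from the multiplicative set [W] is prime. *)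
Lemma prime_avoiding J (W : set R) :
  is_ideal J -> W 1 -> (forall x y, W x -> W y -> W (x * y)) ->
  (forall x, J x -> ~ W x) ->
  exists p, [/\ prime_ideal p, J `<=` p & forall x, p x -> ~ W x].
Proof.
move=> hJ W1 WM hJW.
pose Q := [set p : set R | [/\ is_ideal p, J `<=` p & forall x, p x -> ~ W x]].
have [||p [hp hJp hpW] maxp] := @noethR Q.
- by exists J; split.
- by move=> p [].
exists p; split=> //; split=> // [hp1|x y hxy]; first exact: (hpW 1).
have meets z : ~ p z -> exists2 w, W w & adjoin p z setT w.
  move=> hz; apply: contrapT => hn; apply: hz; apply: (maxp (adjoin p z setT)).
  - split; first exact: adjoin_ideal.
      by apply: (subset_trans hJp); apply: sub_adjoin.
    by move=> w hw Ww; apply: hn; exists w.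
  - exact: sub_adjoin.
  - exact: mem_adjoinT.
apply: contrapT => /not_orP[/meets[w Ww [b hb [u _ e]]] /meets[w' Ww' [b' hb' [u' _ e']]]].
apply: (hpW (w * w')); last exact: WM.
rewrite e e'; have -> : (b + x * u) * (b' + y * u') =
   (b' + y * u') * b + x * u * b' + u * u' * (x * y) by ring.
by apply: idealD => //; [apply: idealD => //|]; apply: idealM.
Qed.

Lemma prime_over J : is_ideal J -> ~ J 1 -> exists2 p, prime_ideal p & J `<=` p.
Proof.
move=> hJ hJ1; have [|||p [hp hJp _]] := @prime_avoiding J [set 1] hJ.
- by [].
- by move=> x y -> ->; rewrite mulr1.
- by move=> x hx e; apply: hJ1; rewrite -e.
by exists p.
Qed.

(** The given chain starts at a prime containing [f] and is prolonged downwards by a prime [q] over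
    [N]. Avoiding the complement of [p 0] puts [q] inside [p 0]; avoiding also the powers of [f],
    possible because [f] is a nonzerodivisor modulo [N], makes the inclusion strict. *)
Lemma prime_chain_cons N N' f e (p : nat -> set R) :
  is_ideal N -> (forall r, N (f * r) -> N r) -> N `<=` N' -> N' f ->
  prime_chain_over N' e p -> exists p', prime_chain_over N e.+1 p'.
Proof.
move=> hN hf hNN' hN'f [hp hlt].
have [[hi h1 hpr] hN'p] := hp 0%N isT.
pose W := [set x | exists i t, ~ p 0%N t /\ x = f ^+ i * t].
have [|||q [hq hNq hqW]] := @prime_avoiding N W hN.
- by exists 0%N, 1; rewrite mulr1.
- move=> _ _ [i [t [ht ->]]] [j [u [hu ->]]].
  exists (i + j)%N, (t * u); split; first by move=> /hpr[].
  by rewrite exprD; ring.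
- move=> x hx [i [t [ht e']]]; apply: ht; apply: hN'p; apply: hNN'.
  move: hx; rewrite e'; elim: i {e'} => [|i IH]; first by rewrite mul1r.
  by rewrite exprS -mulrA => /hf.
exists (fun i => if i is j.+1 then p j else q); split=> [[|i] hi'|[|i] hi'] //.
- by have [hpi h] := hp i hi'; split=> //; apply: subset_trans h.
- split.
    move=> x hx; apply: contrapT => hpx; apply: (hqW x hx).
    by exists 0%N, x; rewrite mul1r.
  move=> /(_ f (hN'p _ hN'f)) qf; apply: (hqW f qf).
  by exists 1%N, 1; rewrite mulr1.
- exact: hlt.
Qed.

(** Each element of [s] is a nonzerodivisor modulo the current annihilator and prolongs the chain by
    one prime; this is depth <= dim. *)
Lemma prime_chain_of_regular A B s a : is_ideal A -> is_ideal B ->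
  weakly_regular A B s -> A a -> ~ quotient_by A B s a ->
  exists p, prime_chain_over (annihilator A B) (size s) p.
Proof.
move=> hA; elim: s B => [|f s IH] B hB /= => [_ ha hBa|[hf hs] ha hna].
  have [||p hp hAp] := @prime_over (annihilator A B).
  - exact: annihilator_ideal.
  - by move=> /(_ a ha); rewrite mul1r.
  by exists (fun=> p).
have [p hp] := IH _ (adjoin_ideal f hB hA) hs ha hna.
apply: (prime_chain_cons (f := f)) hp.
- exact: annihilator_ideal.
- by move=> r hr b hb; apply: hf; [exact: idealM | rewrite mulrA; exact: (hr b hb)].
- by move=> r hr b hb; apply: sub_adjoin => //; exact: (hr b hb).
- by move=> b hb; apply: mem_adjoin.
Qed.

(* The inductive step of [depth <= dim R / p for associated primes p], where
   [colon B a] plays the role of p: an element a' which is not divisible by f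
   modulo B exists by Krull's argument, and it has to be found locally at M. *)
Lemma indivisible_witness M B f a : prime_ideal M -> is_ideal B -> M f ->
  (forall r, B (f * r) -> B r) -> colon B a `<=` M ->
  exists2 a', colon B a `<=` colon B a' & colon (adjoin B f setT) a' `<=` M.
Proof.
move=> [hM M1 MP] hB Mf hf haM; apply: contrapT => hn.
pose good := [set c | colon B a `<=` colon B c /\ colon B c `<=` M].
have div c : good c -> exists u b c', [/\ ~ M u, B b & u * c = b + f * c'].
  move=> [hc1 hc2]; apply: contrapT => hdiv; apply: hn; exists c => // u.
  case=> b hb [c' _ e]; apply: contrapT => hu; apply: hdiv.
  by exists u, b, c'.
(* The ideal generated by [c] in the localization of R / B at [M], pulled back to R. *)
pose sat c := [set x | exists2 u, ~ M u & adjoin B c setT (u * x)].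
pose Q := [set J | exists2 c, good c & J = sat c].
have [||J [c gc ->] maxc] := @noethR Q.
- by exists (sat a); exists a => //; split.
- move=> _ [c _ ->]; have hBc : is_ideal (adjoin B c setT) by exact: adjoin_ideal.
  split.
  + by exists 1 => //; rewrite mulr0; apply: ideal0.
  + move=> x y [u hu hx] [v hv hy]; exists (u * v); first by move=> /MP[].
    have -> : u * v * (x + y) = v * (u * x) + u * (v * y) by ring.
    by apply: idealD => //; apply: idealM.
  + by move=> z x [u hu hx]; exists u => //; rewrite mulrCA; apply: idealM.
have [u [b [c' [hu hb e]]]] := div c gc.
have gc' : good c'.
  case: gc => h1 h2; split=> r.
    move=> /h1; rewrite /colon /= => hr; apply: hf.
    have -> : f * (r * c') = u * (r * c) - r * b.
      by rewrite mulrCA -[u * _]mulrCA e; ring.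
    by apply: idealB => //; apply: idealM.
  rewrite /colon /= => hr; have /MP[|/hu] // : M (r * u).
  apply: h2; rewrite /colon /= -mulrA e mulrDr; apply: idealD => //.
    exact: idealM.
  by rewrite mulrCA; apply: idealM.
have [|||v hv [b' hb' [r _ e']]] := maxc (sat c') _ _ c'.
- by exists c'.
- move=> x [v hv [b1 hb1 [r _ e1]]]; exists (u * v); first by move=> /MP[].
  exists (u * b1 + r * b); last exists (f * r) => //.
    by apply: idealD => //; apply: idealM.
  have -> : u * v * x = u * b1 + r * (u * c) by rewrite -mulrA e1; ring.
  by rewrite e; ring.
- exists 1 => //; rewrite mul1r; exact: mem_adjoinT.
(* Nakayama's argument: [c] and its quotient [c'] by [f] generate the same local ideal, so
   [u v - f r] kills [c'] modulo [B] and lies in [M]; since [f] is in [M], so is [u v]. *)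
suff /(proj2 gc') : colon B c' (u * v - f * r).
  move=> h; have : M (u * v).
    by rewrite -[u * v](subrK (f * r)); apply: idealD => //; apply: idealMr.
  by move=> /MP[].
rewrite /colon /= mulrBl -mulrA e'.
have -> : u * (b' + c * r) - f * r * c' = u * b' + r * (u * c - f * c') by ring.
have -> : u * c - f * c' = b by rewrite e addrK.
by apply: idealD => //; apply: idealM.
Qed.

(** Depth <= dim R / (B : a). Each [f] yields one prime: it is a nonzerodivisor modulo [(B : a)],
    and the witness [a'] has a larger colon ideal modulo [B + (f)], which contains [f] and stays
    inside [M]. *)
Lemma prime_chain_over_colon M B s a : prime_ideal M -> is_ideal B ->
  (forall f, f \in s -> M f) -> weakly_regular setT B s -> colon B a `<=` M ->
  exists p, prime_chain_over (colon B a) (size s) p.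
Proof.
move=> hM; elim: s B a => [|f s IH] B a hB /= hs => [_ haM|[hf hreg] haM].
  have [||p hp hAp] := @prime_over (colon B a).
  - exact: colon_ideal.
  - by move=> /haM; case: hM.
  by exists (fun=> p).
have hfB r : B (f * r) -> B r by exact: hf.
have Mf : M f by apply: hs; rewrite inE eqxx.
have [a' ha' ha'M] := indivisible_witness hM hB Mf hfB haM.
have [|g hg|p hp] := IH (adjoin B f setT) a' _ _ hreg ha'M.
- exact: adjoin_ideal.
- by apply: hs; rewrite inE hg orbT.
apply: (prime_chain_cons (f := f)) hp.
- exact: colon_ideal.
- by move=> r hr; apply: hf => //; rewrite mulrA.
- by move=> r /ha' hr; apply: sub_adjoin.
- by rewrite /colon /=; apply: mem_adjoin.
Qed.

End RegularSequences.

(** * Noetherianity *)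

(** Each selected index minimizes [u] over all later ones. *)
Lemma nondecreasing_subsequence (u : nat -> nat) :
  exists2 phi : nat -> nat, {homo phi : i j / (i < j)%N}
    & {homo (u \o phi) : i j / (i < j)%N >-> (i <= j)%N}.
Proof.
have tail_min N : exists i, (N <= i)%N /\ forall j, (i <= j)%N -> (u i <= u j)%N.
  pose P v := `[< exists2 i, (N <= i)%N & u i = v >].
  have exP : exists v, P v by exists (u N); apply/asboolP; exists N.
  case: (ex_minnP exP) => v /asboolP[i hi <-] hmin.
  exists i; split=> // j hj; apply: hmin; apply/asboolP; exists j => //.
  exact: leq_trans hj.
have [f hf] := choice tail_min.
pose phi k := iter k (fun i => f i.+1) (f 0%N).
have phi_min k j : (phi k <= j)%N -> (u (phi k) <= u j)%N.
  by case: k => [|k]; apply: (proj2 (hf _)).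
have phi_lt : {homo phi : i j / (i < j)%N}.
  by apply: homo_ltn => [|k]; [exact: ltn_trans | exact: (proj1 (hf _))].
exists phi => // i j hij; apply: phi_min; apply: ltnW; exact: phi_lt.
Qed.

Lemma dickson n (a : nat -> 'X_{1..n}) :
  exists i j, (i < j)%N /\ (a i <= a j)%MM.
Proof.
suff [phi hphi mono] : exists2 phi : nat -> nat, {homo phi : i j / (i < j)%N}
    & forall c, c \in enum 'I_n -> {homo (fun i => a (phi i) c) : i j / (i < j)%N >-> (i <= j)%N}.
  exists (phi 0%N), (phi 1%N); split; first exact: hphi.
  by apply/mnm_lepP => c; apply: mono => //; rewrite mem_enum.
elim: (enum 'I_n) => [|c s [phi hphi mono]]; first by exists id.
have [psi hpsi mono'] := nondecreasing_subsequence (fun i => a (phi i) c).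
exists (phi \o psi) => [i j hij|c']; first by apply: hphi; apply: hpsi.
rewrite inE => /orP[/eqP->|hc'] i j hij; first exact: mono'.
by apply: mono => //; apply: hpsi.
Qed.

Section MonomialIdeals.
Variables (k : fieldType) (n : nat).
Implicit Types (p q : {mpoly k[n]}) (m : 'X_{1..n}) (s t C T : {set 'I_n}).
Implicit Types (W : {set {set 'I_n}}).

Lemma exists_minimal_mlead (P : set {mpoly k[n]}) : (exists p, P p) ->
  exists2 p, P p & forall q, P q -> ~ (mlead q < mlead p)%O.
Proof.
case=> p; move e: (mlead p) => m; elim/(well_founded_ind (@ltom_wf n)): m p e.
move=> m IH p e Pp.
have [[q [Pq lt_qp]]|hn] := EM (exists q, P q /\ (mlead q < mlead p)%O).
  by apply: (IH (mlead q)) Pq => //; rewrite -e.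
by exists p => // q Pq lt_qp; apply: hn; exists q.
Qed.

(** In a strictly increasing chain of ideals let [h i] lie in [J i.+1] outside [J i] with minimal
    leading monomial. By Dickson's lemma the leading monomial of some [h i] divides that of a later
    [h j], and cancelling it contradicts the minimality of [h j]. *)
Lemma mpoly_noetherian : noetherian {mpoly k[n]}.
Proof.
move=> Q [J0 QJ0] Qideal; apply: contrapT => hmax.
have step (J : {J | Q J}) :
    exists J' : {J | Q J}, sval J `<` sval J'.
  apply: contrapT => hJ; apply: hmax; exists (sval J); first exact: svalP.
  move=> J' QJ' JJ'; apply: contrapT => hJ'; apply: hJ.
  by exists (exist _ J' QJ').
have [next hnext] := choice step.
pose J i := sval (iter i next (exist _ J0 QJ0)).
have Jideal i : is_ideal (J i) by apply: Qideal; apply: svalP.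
have Jlt i : J i `<` J i.+1 by exact: hnext.
have Jle i j : (i <= j)%N -> J i `<=` J j.
  move=> /subnK <-; elim: (j - i)%N => [//|d IH].
  by apply: subset_trans IH _; exact: (proj1 (Jlt _)).
have pick_h i : exists h, (J i.+1 h /\ ~ J i h) /\
    forall q, J i.+1 q -> ~ J i q -> ~ (mlead q < mlead h)%O.
  have [|h hh hmin] := @exists_minimal_mlead [set p | J i.+1 p /\ ~ J i p].
    apply: contrapT => hn; apply: (proj2 (Jlt i)) => h h1.
    by apply: contrapT => h2; apply: hn; exists h.
  by exists h; split=> // q h1 h2; apply: hmin.
have [h hh] := choice pick_h.
have [i [j [lt_ij le_ij]]] := dickson (fun i => mlead (h i)).
have [[hi hi'] _] := hh i; have [[hj hj'] hjmin] := hh j.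
pose m := (mlead (h j) - mlead (h i))%MM.
have em : (m + mlead (h i))%MM = mlead (h j) by rewrite submK.
pose g := ((h j)@_(mlead (h j)) / (h i)@_(mlead (h i)))%:MP * (h i * 'X_[m]).
have Jg : J j g.
  by apply: idealM => //; apply: idealMr => //; apply: Jle hi.
have hi0 : (h i)@_(mlead (h i)) != 0.
  by rewrite mleadc_eq0; apply/eqP => e; apply: hi'; rewrite e; apply: ideal0.
have hq : ~ J j (h j - g).
  by move=> hJ; apply: hj'; rewrite -(subrK g (h j)); apply: idealD.
apply: (hjmin (h j - g)) => //.
  by apply: idealB => //; apply: (Jle j).
rewrite lt_neqAle; apply/andP; split.
  apply/eqP => e; have /mlead_supp : h j - g != 0.
    by apply/eqP => e0; apply: hq; rewrite e0; apply: ideal0.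
  rewrite mcoeff_msupp e mcoeffB mcoeffCM -{3}em mcoeffMX divfK ?subrr ?eqxx //.
apply: le_trans (mleadB_le _ _) _; rewrite leUx lexx /=.
apply: le_trans (mleadM_le _ _) _; rewrite mleadC add0m.
by apply: le_trans (mleadM_le _ _) _; rewrite mleadXm addmC em.
Qed.

(** * Squarefree monomial ideals *)

Definition supp m : {set 'I_n} := [set i | m i != 0%N].

Lemma suppD m1 m2 : supp (m1 + m2) = supp m1 :|: supp m2.
Proof. by apply/setP=> i; rewrite !inE mnmDE addn_eq0 negb_and. Qed.

Lemma supp_mesym1 s : supp (mesym1 s) = s.
Proof. by apply/setP=> i; rewrite !inE mnmE; case: (i \in s). Qed.

Lemma mesym1_le s m : (mesym1 s <= m)%MM = (s \subset supp m).
Proof.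
apply/mnm_lepP/fintype.subsetP => h i; last first.
  by rewrite mnmE; case: (boolP (i \in s)) => // /h; rewrite inE lt0n.
by move=> hi; have := h i; rewrite mnmE hi inE lt0n.
Qed.

Definition up_closed (W : {set {set 'I_n}}) : Prop :=
  forall s t, s \subset t -> s \in W -> t \in W.

Definition monomial_ideal (W : {set {set 'I_n}}) : set {mpoly k[n]} :=
  [set p | forall m, m \in msupp p -> supp m \in W].

Lemma monomial_ideal_is_ideal W : up_closed W -> is_ideal (monomial_ideal W).
Proof.
move=> upW; split.
- by move=> m; rewrite msupp0.
- move=> p q hp hq m /msuppD_le; rewrite mem_cat => /orP[]; [exact: hp|exact: hq].
- move=> p q hq m /msuppM_le /allpairsP[[m1 m2] /= [_ hm2 ->]].
  by rewrite suppD; apply: upW (hq _ hm2); exact: finset.subsetUr.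
Qed.

Lemma monomial_idealX W m : monomial_ideal W 'X_[m] <-> supp m \in W.
Proof.
split=> [|h m']; first by apply; rewrite msuppX inE.
by rewrite msuppX inE => /eqP->.
Qed.

Lemma monomial_ideal_sub W (I : set {mpoly k[n]}) : is_ideal I ->
  (forall m, supp m \in W -> I 'X_[m]) -> monomial_ideal W `<=` I.
Proof.
move=> hI hW p hp; rewrite (mpolyE p); apply: ideal_sum => // m hm.
by rewrite -mul_mpolyC; apply: idealM => //; apply: hW; apply: hp.
Qed.

Lemma monomial_idealS (W W' : {set {set 'I_n}}) : W \subset W' ->
  monomial_ideal W `<=` monomial_ideal W'.
Proof. by move=> /fintype.subsetP h p hp m /hp /h. Qed.

Lemma monomial_idealT : monomial_ideal [set: {set 'I_n}] = setT.
Proof. by apply/seteqP; split=> // p _ m _; rewrite inE. Qed.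

Lemma graded_monomial_ideal W : up_closed W -> graded_ideal (monomial_ideal W).
Proof.
move=> upW; split; first exact: monomial_ideal_is_ideal.
move=> d p hp m; rewrite pihomogE => /msupp_sum_le /flattenP[ms /mapP[m' hm' ->]].
move=> /msuppZ_le; rewrite msuppX inE => /eqP->; apply: hp.
by move: hm'; rewrite mem_filter => /andP[].
Qed.

Definition interval (s C : {set 'I_n}) : {set {set 'I_n}} :=
  [set t : {set 'I_n} | (s \subset t) && [disjoint t & C]].

(** [monomial_ideal (hits C)] is the prime P_C generated by the variables in [C]. *)
Definition hits (C : {set 'I_n}) : {set {set 'I_n}} :=
  [set t : {set 'I_n} | ~~ [disjoint t & C]].

Lemma disjoint_setUl s t C :
  [disjoint s :|: t & C] = [disjoint s & C] && [disjoint t & C].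
Proof. by rewrite -!finset.setI_eq0 finset.setIUl finset.setU_eq0. Qed.

Lemma disjoint_setU1r i s C : [disjoint s & i |: C] = (i \notin s) && [disjoint s & C].
Proof. by rewrite disjoint_sym disjoint_setUl finset.disjoints1 disjoint_sym. Qed.

Lemma up_closed_hits C : up_closed (hits C).
Proof. by move=> s t st; rewrite !inE; apply/contra/disjointWl. Qed.

Lemma adjoin_interval W s C : up_closed W -> up_closed (W :|: interval s C) ->
  [disjoint s & C] ->
  adjoin (monomial_ideal W) 'X_[mesym1 s] setT = monomial_ideal (W :|: interval s C).
Proof.
move=> upW upW' sC; have hW := monomial_ideal_is_ideal upW.
have hW' := monomial_ideal_is_ideal upW'.
apply/seteqP; split.
  apply: adjoin_sub => //; first by apply: monomial_idealS; exact: finset.subsetUl.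
  move=> p _; apply: (idealMr _ hW'); apply/monomial_idealX.
  by rewrite supp_mesym1 !inE subxx sC orbT.
apply: monomial_ideal_sub; first exact: adjoin_ideal.
move=> m; rewrite inE => /orP[hm|].
  by apply: sub_adjoin => //; apply/monomial_idealX.
rewrite inE => /andP[sm _]; rewrite -(submK (m := mesym1 s) (m' := m)) ?mesym1_le //.
by rewrite addmC mpolyXD; apply: mem_adjoin.
Qed.

(** With [adjoin_interval], this identifies the added piece with S / P_C: a monomial avoiding [C]
    keeps the bottom monomial inside the interval, hence outside [W], while one that meets [C] moves
    it into [W]. *)
Lemma colon_interval W s C : up_closed W -> up_closed (W :|: interval s C) ->
  [disjoint s & C] -> [disjoint W & interval s C] ->
  colon (monomial_ideal W) 'X_[mesym1 s] = monomial_ideal (hits C).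
Proof.
move=> upW upW' sC WI; have hW := monomial_ideal_is_ideal upW.
apply/seteqP; split.
  move=> p hp m hm; rewrite inE; apply/negP => mC.
  have hW1 : supp m :|: s \in W.
    rewrite -[s]supp_mesym1 -suppD; apply: hp.
    by rewrite mcoeff_msupp addmC mcoeffMX -mcoeff_msupp.
  move/pred0P: WI => /(_ (supp m :|: s)) /=.
  by rewrite hW1 !inE finset.subsetUr disjoint_setUl mC sC.
apply: monomial_ideal_sub; first exact: colon_ideal.
move=> m; rewrite inE => mC; rewrite /colon /= -mpolyXD; apply/monomial_idealX.
rewrite suppD supp_mesym1; have : supp m :|: s \in W :|: interval s C.
  apply: (upW' s); first exact: finset.subsetUr.
  by rewrite !inE subxx sC orbT.
by rewrite !inE disjoint_setUl (negbTE mC) andbF orbF.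
Qed.

(** A ring endomorphism with kernel P_C, which makes P_C prime. *)
Definition kill C (p : {mpoly k[n]}) : {mpoly k[n]} :=
  p \mPo [tuple (if i \in C then 0 else 'X_i) | i < n].

Lemma killX C m : kill C 'X_[m] = if [disjoint supp m & C] then 'X_[m] else 0.
Proof.
rewrite /kill comp_mpolyX; case: ifPn => [mC|].
  rewrite mpolyXE_id; apply: eq_bigr => i _; rewrite tnth_mktuple.
  case: ifPn => // iC; have : i \notin supp m.
    by apply: contraL mC => im; apply/pred0Pn; exists i; rewrite /= im.
  by rewrite inE negbK => /eqP->; rewrite !expr0.
case/pred0Pn => i /andP[/= im iC]; move: im; rewrite inE => im.
by rewrite (bigD1 i) //= tnth_mktuple [i \in C]iC expr0n (negbTE im) mul0r.
Qed.

Lemma mcoeff_kill C p m : [disjoint supp m & C] -> (kill C p)@_m = p@_m.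
Proof.
move=> mC; rewrite {2}(mpolyE p) /kill comp_mpolyEX !raddf_sum /=.
apply: eq_bigr => m' _; rewrite !mcoeffZ -/(kill C _) killX.
case: ifPn => // m'C; rewrite mcoeff0 mcoeffX; case: eqP => // e.
by move: m'C; rewrite e mC.
Qed.

Lemma mem_hits_ideal C p : monomial_ideal (hits C) p <-> kill C p = 0.
Proof.
split=> [hp|e m].
  rewrite /kill comp_mpolyEX big_seq big1 // => m hm.
  by rewrite -/(kill C _) killX; have := hp m hm; rewrite inE => /negbTE->; rewrite scaler0.
rewrite mcoeff_msupp inE; apply: contra => mC.
by rewrite -(mcoeff_kill p mC) e mcoeff0.
Qed.

Lemma prime_hits_ideal C : prime_ideal (monomial_ideal (hits C)).
Proof.
split; first by apply: monomial_ideal_is_ideal; exact: up_closed_hits.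
  by move/mem_hits_ideal/eqP; rewrite /kill rmorph1 oner_eq0.
move=> p q /mem_hits_ideal/eqP; rewrite /kill rmorphM mulf_eq0.
by case/orP => /eqP ?; [left|right]; apply/mem_hits_ideal.
Qed.

Lemma adjoin_congr (B : set {mpoly k[n]}) p q : is_ideal B -> B (p - q) ->
  adjoin B p setT = adjoin B q setT.
Proof.
move=> hB; suff sub p1 q1 : B (p1 - q1) -> adjoin B p1 setT `<=` adjoin B q1 setT.
  move=> hpq; apply/seteqP; split; apply: sub => //.
  by rewrite -opprB; apply: idealN.
move=> h _ [b hb [a _ ->]]; exists (b + a * (p1 - q1)); last by exists a => //; ring.
by apply: idealD => //; apply: idealM.
Qed.

Fixpoint esyms d : seq {mpoly k[n]} := if d is d'.+1 then mesym n k d :: esyms d' else [::].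

Lemma size_esyms d : size (esyms d) = d.
Proof. by elim: d => //= d ->. Qed.

Lemma esyms_irrelevant d f : f \in esyms d -> irrelevant_ideal f.
Proof.
elim: d => //= d IH; rewrite inE => /orP[/eqP->|/IH//].
apply/eqP; rewrite mcoeff_eq0 msupp_mesymP; apply/negP => /existsP[s /andP[/eqP hs /eqP e]].
by have := mdeg_mesym1 s; rewrite -e mdeg0 hs.
Qed.

(** The ideal P_C + (X^T), for [T] disjoint from [C]. As [T] shrinks from the complement of [C] to
    the empty set, it grows from P_C plus one monomial to the whole ring. *)
Definition split_hits C T : {set {set 'I_n}} := hits C :|: interval T C.

Lemma up_closed_split_hits C T : up_closed (split_hits C T).
Proof.
move=> s t st; rewrite !inE => hs; case: (boolP [disjoint t & C]) => //= tC.
move: hs; rewrite (disjointWl st tC) /= => /andP[Ts _].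
by rewrite (fintype.subset_trans Ts st).
Qed.

Lemma split_hits0 C : split_hits C finset.set0 = [set: {set 'I_n}]%SET.
Proof. by apply/setP=> s; rewrite !inE finset.sub0set orNb. Qed.

(** A set of the same size as the complement of [C], but different from it, meets [C]. *)
Lemma mesym_hits_ideal C : monomial_ideal (hits C) (mesym n k #|~: C| - 'X_[mesym1 (~: C)]).
Proof.
rewrite mesymE (bigD1 (~: C)) //= addrAC subrr add0r.
have hP : is_ideal (monomial_ideal (hits C)).
  by apply: monomial_ideal_is_ideal; exact: up_closed_hits.
apply: (big_ind (monomial_ideal (hits C))) => [|p q|s /andP[/eqP hs ne]].
- exact: ideal0.
- exact: idealD.
apply/monomial_idealX; rewrite supp_mesym1 inE; apply: contra ne => sC.
by rewrite eqEcard hs leqnn andbT -finset.disjoints_subset.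
Qed.

Lemma mesym_not_hits_ideal C : ~ monomial_ideal (hits C) (mesym n k #|~: C|).
Proof.
move=> /(_ (mesym1 (~: C))); rewrite msupp_mesymP supp_mesym1 inE.
rewrite finset.disjoints_subset subxx => h; suff : false by [].
by apply: h; apply/existsP; exists (~: C); rewrite !eqxx.
Qed.

(** Dropping [i] from [T] adds the sets that avoid [C] and [i] and contain the rest of [T]: a copy
    of S / P_(C + i). *)
Lemma split_hitsD1 C T i : i \in T -> [disjoint T & C] ->
  split_hits C T :|: interval (T :\ i) (i |: C) = split_hits C (T :\ i).
Proof.
move=> iT TC; apply/setP=> s; rewrite !inE.
rewrite disjoint_setU1r.
have -> : (T \subset s) = (i \in s) && (T :\ i \subset s).
  by rewrite -{1}(finset.setD1K iT) finset.subUset finset.sub1set.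
by case: [disjoint s & C]; case: (T :\ i \subset s); case: (i \in s).
Qed.

(* Modulo the prime P_C the first element is the product of the variables
   outside C; killing these variables one by one reduces to the primes
   P_(C + i). *)
Lemma weakly_regular_esyms d C : #|~: C| = d ->
  weakly_regular setT (monomial_ideal (hits C)) (esyms d).
Proof.
elim: d C => //= d IH C cardC; rewrite -{1 2}cardC.
have upC := @up_closed_hits C; have hC := monomial_ideal_is_ideal upC.
split=> [a _|].
  by have [_ _ hprime] := prime_hits_ideal C; case/hprime => // /mesym_not_hits_ideal.
rewrite (adjoin_congr hC (@mesym_hits_ideal C)).
have disjC : [disjoint ~: C & C] by rewrite finset.disjoints_subset.
have upT T := @up_closed_split_hits C T.
rewrite (@adjoin_interval _ _ C) //; last exact: upT.
rewrite -/(split_hits C _).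
suff : forall T, [disjoint T & C] ->
  weakly_regular setT (monomial_ideal (split_hits C T)) (esyms d) by apply.
move=> T; move e: #|T| => c; elim: c T e => [|c IHc] T.
  by move/cards0_eq->; rewrite split_hits0 monomial_idealT => _; apply: weakly_regular_refl.
move=> cardT TC; have /card_gt0P[i iT] : (0 < #|T|)%N by rewrite cardT.
have iC : i \notin C by rewrite (disjointFr TC iT).
have TiC : [disjoint T :\ i & C] by apply: disjointWl TC; apply: finset.subD1set.
have dis : [disjoint T :\ i & i |: C].
  by rewrite disjoint_setU1r TiC !inE eqxx.
have upW : up_closed (split_hits C T :|: interval (T :\ i) (i |: C)).
  by rewrite split_hitsD1.
apply: (weakly_regular_extension (g := 'X_[mesym1 (T :\ i)])) => //.
- exact: monomial_ideal_is_ideal.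
- rewrite (@colon_interval _ _ (i |: C)) //.
    apply: IH; apply: succn_inj; rewrite -cardC (cardsD1 i (~: C)) inE iC.
    by rewrite finset.setCU finset.setIC -finset.setDE.
  apply/pred0P => s /=; rewrite !inE disjoint_setU1r.
  case: (boolP (i \in s)) => [_|nis]; first by rewrite !andbF.
  case: [disjoint s & C]; rewrite ?andbF //= !andbT.
  by case: (boolP (T \subset s)) => // /fintype.subsetP /(_ _ iT); rewrite (negbTE nis).
- rewrite (@adjoin_interval _ _ (i |: C)) // split_hitsD1 //; apply: IHc => //.
  by move: cardT; rewrite (cardsD1 i) iT => -[].
Qed.

(** * Dimension *)

Definition degree_le E p : Prop := forall m, m \in msupp p -> (mdeg m <= E)%N.

Lemma degree_le_sum E (I : Type) (r : seq I) (F : I -> {mpoly k[n]}) :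
  (forall i, degree_le E (F i)) -> degree_le E (\sum_(i <- r) F i).
Proof.
move=> h; apply: (big_ind (degree_le E)) => // [m|p q hp hq m /msuppD_le].
  by rewrite msupp0.
by rewrite mem_cat => /orP[/hp|/hq].
Qed.

Lemma degree_leM E1 E2 p q :
  degree_le E1 p -> degree_le E2 q -> degree_le (E1 + E2) (p * q).
Proof.
move=> hp hq m /msuppM_le /allpairsP[[m1 m2] /= [h1 h2 ->]].
by rewrite mdegD leq_add ?hp ?hq.
Qed.

Lemma degree_leX E p i : degree_le E p -> degree_le (E * i) (p ^+ i).
Proof.
move=> hp; elim: i => [|i IH].
  by move=> m; rewrite expr0 muln0 msupp1 inE => /eqP->; rewrite mdeg0.
by rewrite exprS mulnS; apply: degree_leM.
Qed.

Definition independent_mod (J : set {mpoly k[n]}) (I : finType) (b : I -> {mpoly k[n]}) :=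
  forall c : I -> k, J (\sum_i (c i)%:MP * b i) -> forall i, c i = 0.

(** In a relation modulo [P], reduction modulo [Q] leaves only the terms with exponent 0 of [f], so
    their coefficients vanish; the rest is divisible by [f], which cancels modulo the prime [P]. *)
Lemma independent_mod_powers (P Q : set {mpoly k[n]}) f (I : finType)
    (b : I -> {mpoly k[n]}) K :
  prime_ideal P -> is_ideal Q -> P `<=` Q -> Q f -> ~ P f -> independent_mod Q b ->
  independent_mod P (fun x : 'I_K * I => f ^+ x.1 * b x.2).
Proof.
move=> [hP P1 Pprime] hQ PQ Qf Pf ind.
suff main (c : nat -> I -> k) :
    P (\sum_(i < K) f ^+ i * (\sum_j (c i j)%:MP * b j)) ->
    forall i, (i < K)%N -> forall j, c i j = 0.
  move=> c hc [i j].
  (* Coefficients are extended by 0 from ['I_K] to all of [nat], so that the induction on [K] can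
     shift the index. *)
  pose c' a j := if insub a is Some o then c (o : 'I_K, j) else 0.
  have c'E (o : 'I_K) j' : c' o j' = c (o, j') by rewrite /c' valK.
  rewrite -c'E; apply: main => //; move: hc; congr P.
  under [RHS]eq_bigr do rewrite mulr_sumr.
  rewrite pair_bigA; apply: eq_bigr => -[a j'] _ /=.
  by rewrite c'E mulrCA.
elim: K c => [//|K IH] c; rewrite big_ord_recl expr0 mul1r.
set B := \sum_j _; set rest := \sum_(i < K) _ => hP'.
have erest : rest = f * \sum_(i < K) f ^+ i * (\sum_j (c i.+1 j)%:MP * b j).
  by rewrite mulr_sumr; apply: eq_bigr => i _; rewrite /bump /= exprS mulrA.
have hB : Q B.
  rewrite -(addrK rest B); apply: idealB => //; first exact: PQ.
  by rewrite erest; apply: idealMr.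
have c0 := ind _ hB; have B0 : B = 0.
  by rewrite /B big1 // => j _; rewrite c0 mpolyC0 mul0r.
move: hP'; rewrite B0 add0r erest => /Pprime[//|hrest] [|i] hi j; first exact: c0.
exact: (IH (fun i => c i.+1) hrest i hi j).
Qed.

(** Each inclusion of the chain supplies an [f] whose powers below [K] multiply the size of the
    family by [K]. The constant [D] adds up the sizes of these [f] and is independent of [K]. *)
Lemma independent_of_prime_chain J e (p : nat -> set {mpoly k[n]}) :
  prime_chain_over J e p -> exists D, forall K, exists (I : finType) (b : I -> {mpoly k[n]}),
    [/\ #|I| = (K ^ e)%N, independent_mod (p 0%N) b & forall i, degree_le (D * K) (b i)].
Proof.
elim: e J p => [|e IH] J p [hp hlt].
  exists 0%N => K; exists unit, (fun=> 1); split.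
  - by rewrite card_unit.
  - move=> c; rewrite (bigD1 tt) //= big1 ?addr0; last by case.
    move=> hc [] ; have [[hid h1 _] _] := hp 0%N isT.
    apply: contrapT => /eqP c0; apply: h1; rewrite -mpolyC1 -(mulVf c0) mpolyCM.
    by apply: idealM => //; move: hc; rewrite mulr1.
  - by move=> i m; rewrite msupp1 inE => /eqP->; rewrite mdeg0.
have [|D hD] := IH classical_sets.set0 (fun i => p i.+1).
  by split=> i hi; [split=> //; exact: (proj1 (hp i.+1 hi)) | exact: hlt].
have [P0Q [f Qf Pf]] : p 0%N `<=` p 1%N /\ exists2 f, p 1%N f & ~ p 0%N f.
  have [h1 h2] := hlt 0%N isT; split=> //.
  by apply: contrapT => hn; apply: h2 => f h3; apply: contrapT => h4; apply: hn; exists f.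
exists (D + msize f)%N => K; have [I [b [cardI ind deg]]] := hD K.
exists ('I_K * I)%type, (fun x : 'I_K * I => f ^+ x.1 * b x.2); split.
- by rewrite card_prod card_ord cardI expnS.
- apply: independent_mod_powers ind => //; first exact: (proj1 (hp 0%N isT)).
  by have [[]] := hp 1%N isT.
- move=> [i j]; rewrite addnC mulnDl; apply: degree_leM => // m hm.
  have : degree_le (msize f * i) (f ^+ i).
    by apply: degree_leX => m' /msize_mdeg_lt /ltnW.
  by move=> /(_ m hm) /leq_trans; apply; rewrite leq_mul2l ltnW ?orbT.
Qed.

(** Modulo P_C a polynomial of degree at most [E] is determined by its coefficients at monomials in
    the variables outside [C] with exponents at most [E]. More elements than such monomials satisfy
    a linear relation, found in the kernel of the coefficient matrix. *)
Lemma card_independent C E (I : finType) (b : I -> {mpoly k[n]}) :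
  independent_mod (monomial_ideal (hits C)) b -> (forall i, degree_le E (b i)) ->
  (#|I| <= E.+1 ^ #|~: C|)%N.
Proof.
move=> ind deg.
pose J := {ffun {i : 'I_n | i \notin C} -> 'I_E.+1}.
have cardJ : #|J| = (E.+1 ^ #|~: C|)%N.
  rewrite card_ffun card_ord card_sig; congr (_ ^ _)%N.
  by apply: eq_card => i; rewrite !inE.
rewrite -cardJ leqNgt; apply/negP => ltJI.
pose mon (g : J) : 'X_{1..n} :=
  [multinom (if insub i is Some i' then g i' : nat else 0%N) | i < n].
pose A := \matrix_(x < #|I|, y < #|J|) (b (enum_val x))@_(mon (enum_val y)).
have : kermx A != 0.
  rewrite kermx_eq0 /row_free; apply/negP => /eqP rk.
  by have := rank_leq_col A; rewrite rk leqNgt ltJI.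
case/matrix0Pn => i0 [j0 nz]; have kerA : kermx A *m A = 0 by exact: mulmx_ker.
pose c x := kermx A i0 (enum_rank x).
suff /ind /(_ (enum_val j0)) : monomial_ideal (hits C) (\sum_x (c x)%:MP * b x).
  by rewrite /c enum_valK => e; rewrite e eqxx in nz.
move=> m hm; rewrite inE; apply: contraL hm => mC.
have degm : (mdeg m <= E)%N \/ m \notin msupp (\sum_x (c x)%:MP * b x).
  case: (leqP (mdeg m) E) => hE; [by left | right].
  apply/negP => hm; have : degree_le E (\sum_x (c x)%:MP * b x).
    apply: degree_le_sum => x m'; rewrite mul_mpolyC => /msuppZ_le; exact: deg.
  by move=> /(_ m hm); rewrite leqNgt hE.
case: degm => // degm; rewrite -mcoeff_eq0; apply/eqP.
pose g : J := [ffun i => inord (m (val i))].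
have em : mon g = m.
  apply/mnmP => i; rewrite mnmE; case: insubP => [i' _ ei|].
    rewrite ffunE inordK ?ei // ltnS; apply: leq_trans degm.
    by rewrite mdegE (bigD1 i) //= leq_addr.
  rewrite negbK => iC; apply/esym/eqP.
  by have := disjointFl mC iC; rewrite inE => /negbFE.
move/matrixP: kerA => /(_ i0 (enum_rank g)); rewrite !mxE => kerA.
rewrite raddf_sum /= -[RHS]kerA (reindex enum_rank) /=; last first.
  by exists enum_val => x _; [exact: enum_rankK | exact: enum_valK].
apply: eq_bigr => x _; rewrite mul_mpolyC mcoeffZ; congr (_ * _).
by rewrite mxE !enum_rankK em.
Qed.

Lemma expn_degree_le D d e : (forall K, K ^ e <= (D * K).+1 ^ d)%N -> (e <= d)%N.
Proof.
move=> h; rewrite leqNgt; apply/negP => lt_de.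
(* For this [K], [K ^ d.+1] exceeds [(D.+1 * K) ^ d], which bounds the right-hand side. *)
pose K := (D.+1 ^ d).+1; have := h K; rewrite leqNgt => /negP; apply.
have le1 : ((D * K).+1 <= D.+1 * K)%N by rewrite mulSn -[leqLHS]add1n leq_add2r.
apply: (@leq_ltn_trans ((D.+1 * K) ^ d)%N); first by case: (posnP d) => [-> //|d0]; rewrite leq_exp2r.
rewrite expnMn; apply: (@leq_trans (K * K ^ d)%N).
  by rewrite ltn_pmul2r ?expn_gt0.
by rewrite -expnS leq_pexp2l.
Qed.

Lemma prime_chain_bound C e (p : nat -> set {mpoly k[n]}) :
  prime_chain_over (monomial_ideal (hits C)) e p -> (e <= #|~: C|)%N.
Proof.
move=> hp; have [D hD] := independent_of_prime_chain hp.
apply: (@expn_degree_le D) => K; have [I [b [<- ind deg]]] := hD K.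
apply: card_independent deg => c hc; apply: ind.
by apply: (proj2 (proj1 hp 0%N isT)).
Qed.

(** * Cohen-Macaulay quotients of monomial ideals *)

Lemma prime_irrelevant_ideal : prime_ideal (@irrelevant_ideal k n).
Proof.
split; first split; rewrite /irrelevant_ideal /=.
- exact: mcoeff0.
- by move=> p q hp hq; rewrite mcoeffD hp hq addr0.
- by move=> a p hp; rewrite rmorphM /= hp mulr0.
- by rewrite rmorph1; apply/eqP; rewrite oner_eq0.
- by move=> p q; rewrite rmorphM /= => /eqP; rewrite mulf_eq0 => /orP[]/eqP; [left|right].
Qed.

(** Every regular sequence yields a chain of primes, so a bound on chains and one regular sequence
    reaching it determine both depth and dimension. *)
Lemma CM_module_of_regular (A B : set {mpoly k[n]}) d (s : seq {mpoly k[n]}) :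
  is_ideal A -> is_ideal B ->
  (forall e (p : nat -> set {mpoly k[n]}), prime_chain_over (annihilator A B) e p -> (e <= d)%N) ->
  regular_sequence (@irrelevant_ideal k n) A B s -> size s = d ->
  CM_module A B /\ has_dim A B d.
Proof.
move=> hA hB bound reg sz.
have chain (s' : seq {mpoly k[n]}) : regular_sequence (@irrelevant_ideal k n) A B s' ->
    exists P, prime_chain_over (annihilator A B) (size s') P.
  move=> /(regular_sequenceE _ _ hA hB)[_ hreg [a ha hna]].
  exact: (prime_chain_of_regular mpoly_noetherian hA hB hreg ha hna).
have dimd : has_dim A B d by split=> //; rewrite -sz; apply: chain.
split=> //; exists d => //; split; first by exists s.
by move=> s' /chain[p]; apply: bound.
Qed.

(* Each step adds a copy of S / P_C to the quotient of monomial ideals. *)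
Inductive layer d : {set {set 'I_n}} -> {set {set 'I_n}} -> Prop :=
| layer_refl W : up_closed W -> layer d W W
| layer_step W W' s C : up_closed W -> up_closed (W :|: interval s C) ->
    [disjoint s & C] -> [disjoint W & interval s C] -> #|~: C| = d ->
    layer d (W :|: interval s C) W' -> layer d W W'.

Lemma layer_sub d W W' : layer d W W' -> [/\ up_closed W, up_closed W' & W \subset W'].
Proof.
elim=> {W W'} [W //|W W' s C upW _ _ _ _ _ [_ upW' sub]]; split=> //.
by apply: fintype.subset_trans sub; apply: finset.subsetUl.
Qed.

Lemma layer_regular d W W' : layer d W W' ->
  weakly_regular (monomial_ideal W') (monomial_ideal W) (esyms d).
Proof.
elim=> {W W'} [W upW|W W' s C upW upW1 sC WI cardC hl IH].
  by apply: weakly_regular_refl; apply: monomial_ideal_is_ideal.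
have [_ upW' sub] := layer_sub hl.
apply: (weakly_regular_extension (g := 'X_[mesym1 s])).
- exact: monomial_ideal_is_ideal.
- exact: monomial_ideal_is_ideal.
- by apply: monomial_idealS; apply: fintype.subset_trans sub; apply: finset.subsetUl.
- apply/monomial_idealX; rewrite supp_mesym1; apply: (fintype.subsetP sub).
  by rewrite !inE subxx sC orbT.
- by rewrite (@colon_interval _ _ C) //; apply: weakly_regular_esyms.
- by rewrite (@adjoin_interval _ _ C).
Qed.

(** Multiplication by an element of P_C outside [p] turns annihilators of the rest of the layer into
    annihilators of the whole, so [p] contains the annihilator of the rest. Every chain of primes
    over the annihilator thus lies over some P_C, which bounds the dimension. *)
Lemma layer_prime d W W' (p : set {mpoly k[n]}) : layer d W W' -> prime_ideal p ->
  annihilator (monomial_ideal W') (monomial_ideal W) `<=` p ->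
  exists2 C, #|~: C| = d & monomial_ideal (hits C) `<=` p.
Proof.
move=> hl hp; have [hpi p1 pM] := hp.
elim: hl => {W W'} [W upW|W W' s C upW upW1 sC WI cardC hl IH] hann.
  by case: p1; apply: hann => a; rewrite mul1r.
have [|hn] := EM (monomial_ideal (hits C) `<=` p); first by exists C.
apply: IH => r hr; apply: contrapT => pr; apply: hn => u hu; apply: contrapT => pu.
suff : p (r * u) by move=> /pM[].
apply: hann; apply: (annihilator_extension (g := 'X_[mesym1 s])).
- exact: monomial_ideal_is_ideal.
- by rewrite (@adjoin_interval _ _ C).
- by rewrite (@colon_interval _ _ C).
Qed.

(** Nakayama for a minimal generator: if [s] is a smallest set in [W'] outside [W], no divisor of
    its squarefree monomial occurs in the ideal of [W], nor in an element of the ideal of [W']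
    multiplied by a polynomial without constant term. *)
Lemma monomial_quotient_nondegenerate W W' s0 (fs : seq {mpoly k[n]}) :
  up_closed W -> up_closed W' -> s0 \in W' -> s0 \notin W ->
  (forall f, f \in fs -> irrelevant_ideal f) ->
  exists2 a, monomial_ideal W' a
    & ~ quotient_by (monomial_ideal W') (monomial_ideal W) fs a.
Proof.
move=> upW upW' s0W' s0W hfs.
pose new := [pred s : {set 'I_n} | (s \in W') && (s \notin W)].
have P0 : new s0 by rewrite /= s0W'.
case: (arg_minnP (fun s : {set 'I_n} => #|s|) P0) => s /andP[sW' sW] smin.
pose K := [set p : {mpoly k[n]} | forall m, (m <= mesym1 s)%MM -> p@_m = 0].
have nosupp p m : (forall m', m' \in msupp p -> (m' <= m)%MM -> False) -> p@_m = 0.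
  move=> h; apply/eqP; rewrite mcoeff_eq0; apply/negP => hm.
  by apply: (h m) => //; apply: lepm_refl.
have subs m : (m <= mesym1 s)%MM -> supp m \subset s.
  move=> /mnm_lepP h; apply/fintype.subsetP => i; rewrite inE => mi.
  by have := h i; rewrite mnmE; case: (i \in s) => //; rewrite leqn0 (negbTE mi).
exists 'X_[mesym1 s]; first by apply/monomial_idealX; rewrite supp_mesym1.
suff sub : quotient_by (monomial_ideal W') (monomial_ideal W) fs `<=` K.
  move=> /sub /(_ _ (lepm_refl _)) /eqP.
  by rewrite mcoeffX eqxx oner_eq0.
apply: quotient_by_sub.
- split.
  + by move=> m _; rewrite mcoeff0.
  + by move=> p q hp hq m hm; rewrite mcoeffD hp // hq // addr0.
  + move=> a p hp m hm; apply: contrapT => /eqP; rewrite -mcoeff_msupp.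
    move=> /msuppM_le /allpairsP[[m1 m2] /= [_ + em]].
    rewrite mcoeff_msupp hp ?eqxx //; apply: lepm_trans hm.
    by rewrite em lem_addl.
- move=> p hp m hm; apply: contrapT => /eqP; rewrite -mcoeff_msupp => /hp mW.
  by move/negP: sW; apply; apply: upW mW; apply: subs.
- move=> f a /hfs f0 ha m hm; apply: contrapT => /eqP; rewrite -mcoeff_msupp.
  move=> /msuppM_le /allpairsP[[m1 m2] /= [h1 /ha h2 em]].
  have m10 : m1 != 0%MM.
    by apply: contraTneq h1 => ->; rewrite mcoeff_msupp f0 eqxx.
  have le2 : (m2 <= mesym1 s)%MM by apply: lepm_trans hm; rewrite em lem_addl.
  have sub2 := subs _ le2.
  have m2W : supp m2 \notin W.
    by apply: contra sW => h; apply: upW h.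
  have := smin (supp m2); rewrite /= h2 m2W => /(_ isT) card2.
  have : supp m2 == s by rewrite eqEcard sub2.
  move=> /eqP e2; have : (mesym1 s <= m2)%MM by rewrite mesym1_le e2.
  move=> le3; move/eqP: m10; apply; apply/mnmP => i.
  have := lepm_trans hm le3; rewrite em => /mnm_lepP /(_ i).
  by rewrite mnmDE mnm0E -{2}[m2 i]add0n leq_add2r leqn0 => /eqP.
Qed.

Lemma layer_CM d W W' : layer d W W' -> W' != W ->
  CM_module (monomial_ideal W') (monomial_ideal W) /\
  has_dim (monomial_ideal W') (monomial_ideal W) d.
Proof.
move=> hl ne; have [upW upW' sub] := layer_sub hl.
have : ~~ (W' \subset W).
  by apply: contra ne => h; rewrite finset.eqEsubset h.
case/subsetPn => s0 s0W' s0W.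
apply: (CM_module_of_regular (s := esyms d)); rewrite ?size_esyms //.
- exact: monomial_ideal_is_ideal.
- exact: monomial_ideal_is_ideal.
- move=> e p [hp hlt]; have [hprime hann] := hp 0%N isT.
  have [C cardC hC] := layer_prime hl hprime hann.
  rewrite -cardC; apply: (@prime_chain_bound C e p); split=> // i hi.
  split; first exact: (proj1 (hp i hi)).
  apply: (classical_sets.subset_trans hC).
  elim: i hi => [|i IHi] hi; first by [].
  apply: (classical_sets.subset_trans (IHi (ltnW hi))).
  exact: (proj1 (hlt i hi)).
- apply/regular_sequenceE; [exact: monomial_ideal_is_ideal..|split].
  + exact: esyms_irrelevant.
  + exact: layer_regular.
  + by apply: monomial_quotient_nondegenerate s0W' s0W _ => //; exact: esyms_irrelevant.
Qed.

(** * Filtrations from a partition of the faces into labelled intervals *)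

Section Shelling.
Variables (W0 : {set {set 'I_n}}) (L : Type).
Variables (label : {set 'I_n} -> L -> Prop) (low cut : L -> {set 'I_n}) (weight : L -> nat).
Hypothesis up0 : up_closed W0.
Hypothesis label_ex : forall s, s \notin W0 -> exists l, label s l.
Hypothesis label_face : forall s l, label s l -> s \notin W0.
Hypothesis label_uniq : forall s l l', label s l -> label s l' -> l = l'.
Hypothesis label_interval :
  forall s l, label s l -> forall t, label t l <-> t \in interval (low l) (cut l).
(** The first half makes the bounds on the dimension compatible with inclusion; the second orders
    the intervals of one dimension, so that lighter ones, which lie higher, can be added first. *)
Hypothesis label_mono : forall s t l l', label s l -> label t l' -> s \subset t ->
  (#|cut l| <= #|cut l'|)%N /\
  (#|cut l| = #|cut l'| -> l = l' \/ (weight l' < weight l)%N).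

Definition dim_lt d : {set {set 'I_n}} :=
  [set s | (s \in W0) || `[< exists2 l, label s l & (#|~: cut l| < d)%N >]].

Lemma dim_ltP s d l : label s l -> (s \in dim_lt d) = (s \in W0) || (#|~: cut l| < d)%N.
Proof.
move=> hl; rewrite inE; congr (_ || _); apply/asboolP/idP => [[l' hl' lt]|lt].
  by rewrite (label_uniq hl hl').
by exists l.
Qed.

Lemma leq_card_setC s t : (#|s| <= #|t|)%N -> (#|~: t| <= #|~: s|)%N.
Proof. by have := cardsC s; have := cardsC t; lia. Qed.

Lemma ltn_card_setC s t : (#|s| < #|t|)%N -> (#|~: t| < #|~: s|)%N.
Proof. by have := cardsC s; have := cardsC t; lia. Qed.

Lemma up_closed_dim_lt d : up_closed (dim_lt d).
Proof.
move=> s t st; have [sW|sW] := boolP (s \in W0).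
  by move=> _; rewrite inE (up0 st).
have [l hl] := label_ex sW; rewrite (dim_ltP d hl) (negbTE sW) /= => lt.
have [tW|/label_ex[l' hl']] := boolP (t \in W0); first by rewrite inE tW.
rewrite (dim_ltP d hl') orbC (leq_ltn_trans _ lt) //.
by apply: leq_card_setC; case: (label_mono hl hl' st).
Qed.

Lemma dim_lt0 : dim_lt 0 = W0.
Proof.
by apply/setP=> s; rewrite inE; case: asboolP => [[l]|]; rewrite ?orbF.
Qed.

Lemma dim_ltT : dim_lt n.+1 = [set: {set 'I_n}]%SET.
Proof.
apply/setP=> s; rewrite [RHS]inE; have [sW|/label_ex[l hl]] := boolP (s \in W0).
  by rewrite inE sW.
by rewrite (dim_ltP _ hl) ltnS -[leqRHS]card_ord max_card orbT.
Qed.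

Lemma dim_ltS d : dim_lt d \subset dim_lt d.+1.
Proof.
apply/fintype.subsetP => s; rewrite !inE => /orP[->//|/asboolP[l hl lt]].
by apply/orP; right; apply/asboolP; exists l => //; apply: ltnW.
Qed.

(** The missing classes of dimension [d] are added by increasing weight: a face above the new class
    lies in the class itself, or in one of smaller weight or dimension that is already present. The
    last hypothesis says that [W] is a union of whole classes, which makes the new interval disjoint
    from [W]. *)
Lemma layer_above d W : up_closed W -> dim_lt d \subset W -> W \subset dim_lt d.+1 ->
  (forall s t l, label s l -> label t l -> s \in W -> t \in W) ->
  layer d W (dim_lt d.+1).
Proof.
move e: #|dim_lt d.+1 :\: W| => c; elim/ltn_ind: c W e => c IH W e upW sub1 sub2 sat.
have [sub3|] := boolP (dim_lt d.+1 \subset W).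
  have -> : dim_lt d.+1 = W by apply/eqP; rewrite finset.eqEsubset sub3.
  exact: layer_refl.
case/subsetPn => s0 s0U s0W.
have s00 : s0 \notin W0.
  by apply: contra s0W => h; apply: (fintype.subsetP sub1); rewrite inE h.
have [l0 hl0] := label_ex s00.
pose P v := `[< exists s l, [/\ s \in dim_lt d.+1, s \notin W, label s l & weight l = v] >].
have exP : exists v, P v by exists (weight l0); apply/asboolP; exists s0, l0.
case: (ex_minnP exP) => v /asboolP[s [l [sU sW hl <-]]] hmin.
have sN : s \notin W0.
  by apply: contra sW => h; apply: (fintype.subsetP sub1); rewrite inE h.
have cardC : #|~: cut l| = d.
  apply/eqP; rewrite eqn_leq; move: sU; rewrite (dim_ltP _ hl) (negbTE sN) /= ltnS => -> /=.
  rewrite leqNgt; apply: contra sW => lt; apply: (fintype.subsetP sub1).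
  by rewrite (dim_ltP _ hl) lt orbT.
have hI := label_interval hl.
have sI : s \in interval (low l) (cut l) by apply/hI.
have lowcut : [disjoint low l & cut l].
  by move: sI; rewrite inE => /andP[]; exact: disjointWl.
set W1 := W :|: interval (low l) (cut l).
have labelU t l' : label t l' -> (#|~: cut l'| <= d)%N -> t \in dim_lt d.+1.
  by move=> hl' le; rewrite (dim_ltP _ hl') ltnS le orbT.
have upW1 : up_closed W1.
  move=> a b ab; rewrite !inE => /orP[/(upW _ _ ab)->//|]; rewrite -[_ && _]/(_).
  move=> aI; have ha : label a l by apply/hI; rewrite inE.
  have [bW|bW] := boolP (b \in W) => //=.
  have bN : b \notin W0.
    by apply: contra bW => h; apply: (fintype.subsetP sub1); rewrite inE h.
  have [l' hl'] := label_ex bN; have [le1 le2] := label_mono ha hl' ab.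
  have [ecard|ncard] := eqVneq #|cut l| #|cut l'|.
    case: (le2 ecard) => [el|ltw].
      by move: hl'; rewrite -el => /hI; rewrite inE.
    suff : (weight l <= weight l')%N by rewrite leqNgt ltw.
    apply: hmin; apply/asboolP; exists b, l'; split=> //.
    by apply: (labelU _ _ hl'); rewrite -cardC leq_card_setC.
  case/negP: bW; apply: (fintype.subsetP sub1); rewrite (dim_ltP _ hl').
  by rewrite -cardC ltn_card_setC ?orbT // ltn_neqAle ncard.
have dis : [disjoint W & interval (low l) (cut l)].
  apply/pred0P => t /=; apply/negP => /andP[tW /hI ht].
  by case/negP: sW; apply: (sat t s l).
apply: (layer_step (s := low l) (C := cut l)) => //.
apply: (IH #|dim_lt d.+1 :\: W1|) => //.
- rewrite -e; apply: proper_card; apply/properP; split.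
    by apply: finset.setDS; apply: finset.subsetUl.
  by exists s; rewrite finset.in_setD ?sU ?sW //= finset.in_setU sI orbT.
- by apply: fintype.subset_trans sub1 _; apply: finset.subsetUl.
- rewrite finset.subUset sub2; apply/fintype.subsetP => t /hI ht.
  by apply: (labelU _ _ ht); rewrite cardC.
- move=> a b l' ha hb; rewrite !finset.in_setU => /orP[aW|/hI ha'].
    by rewrite (sat a b l').
  by apply/orP; right; apply/hI; rewrite (label_uniq ha' ha).
Qed.

Lemma dim_lt_layer d : layer d (dim_lt d) (dim_lt d.+1).
Proof.
apply: layer_above; rewrite ?subxx ?dim_ltS //; first exact: up_closed_dim_lt.
move=> s t l hs ht; rewrite (dim_ltP _ hs) (dim_ltP _ ht) (negbTE (label_face hs)) /= => ->.
by rewrite orbT.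
Qed.

Lemma sequentially_CM_shelling : sequentially_CM (monomial_ideal W0).
Proof.
(* The extra bound [dm i < D] keeps the dimensions strictly increasing when a layer of dimension [D]
   is appended. *)
suff main D : exists (l : nat) (F : nat -> set {mpoly k[n]}) (dm : nat -> nat),
    [/\ F 0%N = monomial_ideal W0 /\ F l = monomial_ideal (dim_lt D),
        forall i, (i <= l)%N -> graded_ideal (F i),
        forall i, (i < l)%N -> F i `<` F i.+1,
        forall i, (i < l)%N -> CM_module (F i.+1) (F i) /\
                               has_dim (F i.+1) (F i) (dm i) /\ (dm i < D)%N
      & forall i, (i.+1 < l)%N -> (dm i < dm i.+1)%N].
  have [l [F [dm [h1 h2 h3 h4 h5]]]] := main n.+1.
  exists l, F, dm; split=> //; last by move=> i /h4[? []].
  by move: h1; rewrite dim_ltT monomial_idealT.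
elim: D => [|D [l [F [dm [[F0 Fl] h2 h3 h4 h5]]]]].
  exists 0%N, (fun=> monomial_ideal W0), (fun=> 0%N).
  by rewrite dim_lt0; split=> // i _; apply: graded_monomial_ideal.
(* An empty layer is skipped, because the inclusions must be strict. *)
have [e|ne] := eqVneq (dim_lt D.+1) (dim_lt D).
  exists l, F, dm; rewrite e; split=> // i /h4[? [? ?]]; split=> //; split=> //.
  exact: ltnW.
have [cm hd] := layer_CM (dim_lt_layer D) ne.
exists l.+1, (fun i => if (i <= l)%N then F i else monomial_ideal (dim_lt D.+1)),
  (fun i => if (i < l)%N then dm i else D); split.
- by rewrite ltnn.
- move=> i _; case: ifP => [/h2//|_]; apply: graded_monomial_ideal.
  exact: up_closed_dim_lt.
- move=> i; rewrite ltnS => hi; rewrite hi; case: ltnP => [/h3//|hi'].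
  have -> : i = l by apply/eqP; rewrite eqn_leq hi.
  rewrite Fl; split; first by apply: monomial_idealS; exact: dim_ltS.
  move=> sub; case/eqP: ne; apply/eqP; rewrite finset.eqEsubset dim_ltS andbT.
  apply/fintype.subsetP => s; rewrite -{1}[s]supp_mesym1 => /monomial_idealX /sub.
  by move=> /monomial_idealX; rewrite supp_mesym1.
- move=> i; rewrite ltnS => hi; rewrite hi; case: ltnP => [/h4[? [? lt]]|hi'].
    by split=> //; split=> //; apply: ltnW.
  have -> : i = l by apply/eqP; rewrite eqn_leq hi.
  by rewrite Fl.
- move=> i; rewrite ltnS => hi; rewrite hi; case: (ltnP i.+1 l) => [lt|hi']; first exact: h5.
  by have [_ []] := h4 i hi.
Qed.

Lemma cohen_macaulay_shelling d : (exists s, s \notin W0) ->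
  (forall s l, label s l -> #|~: cut l| = d) -> cohen_macaulay (monomial_ideal W0).
Proof.
move=> [s sW] hd; have e0 : dim_lt d = W0.
  apply/setP=> t; have [tW|/[dup] tW /label_ex[l hl]] := boolP (t \in W0).
    by rewrite inE tW.
  by rewrite (dim_ltP _ hl) (hd t l hl) ltnn (negbTE tW).
have eT : dim_lt d.+1 = [set: {set 'I_n}]%SET.
  apply/setP=> t; rewrite [RHS]inE.
  have [tW|/label_ex[l hl]] := boolP (t \in W0); first by rewrite inE tW.
  by rewrite (dim_ltP _ hl) (hd t l hl) ltnSn orbT.
have := dim_lt_layer d; rewrite e0 eT => /layer_CM[].
  by apply/eqP => e; move: sW; rewrite -e inE.
by rewrite monomial_idealT.
Qed.
End Shelling.

(** Minimality of [C] makes the colon ideal at the product of the variables outside [C] contain P_C,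
    so depth <= n - #|C|. The cover [C'] puts the ideal inside P_C', so dim >= n - #|C'|. *)
Lemma cohen_macaulay_cover_card W C C' : up_closed W ->
  (forall s, s \in W -> ~~ [disjoint s & C]) ->
  (forall i, i \in C -> i |: ~: C \in W) ->
  (forall s, s \in W -> ~~ [disjoint s & C']) ->
  cohen_macaulay (monomial_ideal W) -> (#|C| <= #|C'|)%N.
Proof.
move=> upW cover min cover' [d [_ dimd] [[s size_s reg] _]].
have hW := monomial_ideal_is_ideal upW.
have CW : ~: C \notin W by apply/negP => /cover; rewrite finset.disjoints_subset subxx.
have [Ms wreg _] := (regular_sequenceE _ _ (setT_ideal _) hW).1 reg.
have [|p [hp hlt]] := prime_chain_over_colon (a := 'X_[mesym1 (~: C)])
    mpoly_noetherian prime_irrelevant_ideal hW Ms wreg.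
- move=> r hr; apply: contrapT => /eqP r0; case/negP: CW.
  rewrite -[~: C]supp_mesym1; apply: hr.
  by have := mcoeffMX r (mesym1 (~: C)) 0%MM; rewrite addm0 mcoeff_msupp => ->.
- have le_d : (d <= #|~: C|)%N.
    rewrite -size_s; apply: (@prime_chain_bound C _ p); split=> // i hi.
    have [? h] := hp i hi; split=> //; apply: classical_sets.subset_trans h.
    apply: monomial_ideal_sub; first exact: colon_ideal.
    move=> m; rewrite inE => /pred0Pn[c /andP[/= cm cC]].
    rewrite /colon /= -mpolyXD; apply/monomial_idealX; rewrite suppD supp_mesym1.
    apply: upW (min c cC); apply: finset.setSU.
    by rewrite finset.sub1set.
  have upC := @up_closed_hits C'; have hC := monomial_ideal_is_ideal upC.
  have [||a _ hna] := @monomial_quotient_nondegenerate (hits C') [set: _]%SET (~: C')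
     (esyms #|~: C'|) upC _ (finset.in_setT _) _ (@esyms_irrelevant _).
  + by move=> u v _ _; rewrite inE.
  + by rewrite inE finset.disjoints_subset subxx.
  rewrite monomial_idealT in hna.
  have [q [hq hqlt]] := prime_chain_of_regular mpoly_noetherian (setT_ideal _) hC
    (weakly_regular_esyms (erefl _)) I hna.
  have : (size (esyms #|~: C'|) <= d)%N.
    apply: (dimd _ q); split=> // i hi; have [? h] := hq i hi; split=> //.
    apply: classical_sets.subset_trans h => r hr f _.
    have /monomial_idealS/(_ _ (hr 1 I)) : W \subset hits C'.
      by apply/fintype.subsetP => u /cover'; rewrite inE.
    by rewrite mulr1; apply: idealMr.
  rewrite size_esyms => /leq_trans /(_ le_d) le.
  by rewrite leqNgt; apply/negP => /ltn_card_setC; rewrite ltnNge le.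
Qed.
End MonomialIdeals.

(** * Greedy covers *)

Section Greedy.
Variables N t : nat.
Implicit Types (b : pred nat) (L : seq nat).

(** [b x] says that position [x] belongs to the face, [p] is the start of the first window not yet
    hit, and [g] is the last gap in that window; the next window that misses [g] starts at
    [g.+1]. *)
Fixpoint greedy b p L : Prop :=
  if L is g :: L' then
    [/\ (p + t <= N)%N, (p <= g < p + t)%N, ~~ b g,
        forall x, (g < x < p + t)%N -> b x & greedy b g.+1 L']
  else (N < p + t)%N.

(** The positions that must be in the face for each [g] to be the last gap of its window: the bottom
    of the interval labelled [L]. *)
Fixpoint forced p L : seq nat :=
  if L is g :: L' then iota g.+1 (p + t - g.+1) ++ forced g.+1 L' else [::].

Lemma greedy_uniq b p L L' : greedy b p L -> greedy b p L' -> L = L'.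
Proof.
elim: L p L' => [|g L IH] p [|g' L'] //=; first by move=> h []; lia.
  by case; lia.
move=> [h1 h2 h3 h4 h5] [h1' h2' h3' h4' h5'].
have e : g = g'.
  apply/eqP; case: (ltngtP g g') => // lt.
    by case/negP: h3'; apply: h4; lia.
  by case/negP: h3; apply: h4'; lia.
by rewrite -e in h5' *; rewrite (IH _ _ h5 h5').
Qed.

Lemma greedy_ex b p :
  (forall i, (p <= i)%N -> (i + t <= N)%N -> exists2 x, (i <= x < i + t)%N & ~~ b x) ->
  exists L, greedy b p L.
Proof.
move e: (N - p)%N => c; elim/ltn_ind: c p e => c IH p e h.
have [lt|le] := ltnP N (p + t); first by exists [::].
pose P x := (p <= x < p + t)%N && ~~ b x.
have exP : exists x, P x.
  by have [x h1 h2] := h p (leqnn _) le; exists x; rewrite /P h1.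
have ubP x : P x -> (x <= p + t)%N by move=> /andP[]; lia.
case: (ex_maxnP exP ubP) => g /andP[hg nbg] gmax.
have [||L hL] := IH (N - g.+1)%N _ g.+1 erefl; first by lia.
  by move=> i h1 h2; apply: h => //; lia.
exists (g :: L); split=> // x hx; apply: contraT => nbx.
by have := gmax x; rewrite /P nbx andbT; lia.
Qed.

Lemma greedy_hits b p L i : greedy b p L -> (p <= i)%N -> (i + t <= N)%N ->
  exists2 x, (i <= x < i + t)%N & ~~ b x.
Proof.
elim: L p => [|g L IH] p /=; first by lia.
move=> [h1 h2 h3 h4 h5] pi iN; have [le|lt] := leqP i g; last exact: (IH g.+1).
by exists g => //; lia.
Qed.

(** The successors combine the weak inequality [p <= g] and the strict increase of [L] in one strict
    path. *)
Lemma greedy_sorted b p L : greedy b p L -> path ltn p (map S L) /\ all (gtn N) L.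
Proof.
elim: L p => [//|g L IH] p /= [h1 h2 h3 h4 /IH[-> ->]].
by rewrite !andbT; lia.
Qed.

Lemma greedy_uniq_seq b p L : greedy b p L -> uniq L.
Proof.
move=> /greedy_sorted[/path_sorted + _] => /(sorted_uniq ltn_trans ltnn).
by rewrite map_inj_uniq //; apply: succn_inj.
Qed.

Lemma greedy_forced_lt b p L : greedy b p L -> all (gtn N) (forced p L).
Proof.
elim: L p => [//|g L IH] p /= [h1 h2 h3 h4 /IH]; rewrite all_cat => ->.
by rewrite andbT; apply/allP => x; rewrite mem_iota /=; lia.
Qed.

Lemma greedy_interval b b' p L : greedy b p L ->
  greedy b' p L <-> (forall x, x \in forced p L -> b' x) /\ (forall x, x \in L -> ~~ b' x).
Proof.
elim: L p => [|g L IH] p /=; first by move=> h; split.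
move=> [h1 h2 h3 h4 h5]; split.
  move=> [_ _ h3' h4' /(IH _ h5)[h6 h7]]; split=> x.
    by rewrite mem_cat mem_iota => /orP[hx|/h6//]; apply: h4'; lia.
  by rewrite inE => /orP[/eqP->//|/h7].
move=> [h6 h7]; split=> //.
- by apply: h7; rewrite inE eqxx.
- by move=> x hx; apply: h6; rewrite mem_cat mem_iota; apply/orP; left; lia.
- apply/(IH _ h5); split=> x hx; first by apply: h6; rewrite mem_cat hx orbT.
  by apply: h7; rewrite inE hx orbT.
Qed.

(** Enlarging the face can only move the last gaps to the left, so windows start no later and at
    least as many gaps are needed. For lists of equal length the entries compare one by one, and
    unless the lists coincide their sum drops; hence [sumn] as weight. *)
Lemma greedy_mono b b' p p' L L' : greedy b p L -> greedy b' p' L' ->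
  (p' <= p)%N -> (forall x, b x -> b' x) ->
  (size L <= size L')%N /\ (size L = size L' -> L = L' \/ (sumn L' < sumn L)%N).
Proof.
elim: L p p' L' => [|g L IH] p p' [|g' L'] //=.
- by move=> _ _ _ _; split=> // _; left.
- by move=> [? ? ? ? ?] ?; lia.
move=> [h1 h2 h3 h4 h5] [h1' h2' h3' h4' h5'] pp' bb'.
have gg' : (g' <= g)%N.
  rewrite leqNgt; apply/negP => lt; case/negP: h3'; apply: bb'; apply: h4; lia.
have [IH1 IH2] := IH g.+1 g'.+1 L' h5 h5' gg' bb'.
split=> // -[/IH2[->|lt]]; last by right; lia.
by have [->|ne] := eqVneq g g'; [left|right; lia].
Qed.

Lemma greedy_size1 b L : (0 < t)%N -> N = t -> greedy b 0 L -> size L = 1%N.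
Proof.
move=> t0 eN; case: L => [|g [|h L]] //=; first by lia.
by move=> [? ? ? ? []]; lia.
Qed.

Lemma greedy_size2 b L : (0 < t)%N -> N = (2 * t)%N -> greedy b 0 L -> size L = 2%N.
Proof.
move=> t0 eN; case: L => [|g [|h [|h' L]]] //=; first by lia.
  by move=> [? ? ? ?]; lia.
move=> [? hg ? hb [? hh nb ? []]] ? *.
(* The positions after [g] and before [t] are in the face, so the second gap [h] is at least [t] and
   no third window fits. *)
have [lt|?] := ltnP h t; last by lia.
by case/negP: nb; apply: hb; lia.
Qed.
End Greedy.

Arguments monomial_ideal k {n} W _.

Definition nonfaces n (gens : seq (seq 'I_n)) : {set {set 'I_n}} :=
  [set s : {set 'I_n} | has (all (mem s)) gens].

Lemma up_closed_nonfaces n (gens : seq (seq 'I_n)) : up_closed (nonfaces gens).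
Proof.
move=> s t /fintype.subsetP st; rewrite !inE; apply: sub_has => c.
by apply: sub_all => i; apply: st.
Qed.

(** * The path ideal of a single chain *)

Section Line.
Variables (k : fieldType) (n : nat) (w : seq 'I_n) (t : nat).
Hypotheses (uniq_w : uniq w) (t_gt0 : (0 < t)%N).
Implicit Types (s : {set 'I_n}) (X : seq nat).

Definition windows : seq (seq 'I_n) :=
  [seq take t (drop i w) | i <- iota 0 (size w).+1 & (i + t <= size w)%N].

Definition bit s : pred nat := nth false [seq v \in s | v <- w].

Definition marked X : {set 'I_n} := [set v | (v \in w) && (index v w \in X)].

Lemma bit_index s v : v \in w -> bit s (index v w) = (v \in s).
Proof. by move=> vw; rewrite /bit (nth_map v) ?index_mem // nth_index. Qed.

Lemma index_ex x : (x < size w)%N -> exists2 v, v \in w & index v w = x.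
Proof.
case: w uniq_w => [//|v0 w'] uw hx; exists (nth v0 (v0 :: w') x).
  exact: mem_nth.
exact: index_uniq.
Qed.

Lemma nonfaces_windowsP s : reflect
  (exists2 i, (i + t <= size w)%N & forall x, (i <= x < i + t)%N -> bit s x)
  (s \in nonfaces windows).
Proof.
have allE i : (i + t <= size w)%N ->
    all (mem s) (take t (drop i w)) <-> forall x, (i <= x < i + t)%N -> bit s x.
  move=> le; have -> : all (mem s) (take t (drop i w)) =
      all id (take t (drop i [seq v \in s | v <- w])).
    by rewrite -map_drop -map_take all_map.
  have sz : size (take t (drop i [seq v \in s | v <- w])) = t.
    by rewrite size_takel // size_drop size_map -[leqLHS](addKn i) leq_sub2r.
  split=> [/(all_nthP false) h x hx|h].
    by have := h (x - i)%N; rewrite sz nth_take ?nth_drop ?subnKC; [apply|..]; lia.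
  apply/(all_nthP false) => x; rewrite sz => hx; rewrite nth_take // nth_drop.
  by apply: h; lia.
rewrite inE; apply: (iffP hasP) => [[c /mapP[i]]|[i le h]].
  by rewrite mem_filter => /andP[le _] -> /allE h; exists i => //; apply: h.
exists (take t (drop i w)); last exact/allE.
by apply/mapP; exists i => //; rewrite mem_filter le mem_iota; lia.
Qed.

Lemma faceP s : (s \notin nonfaces windows) <->
  forall i, (0 <= i)%N -> (i + t <= size w)%N -> exists2 x, (i <= x < i + t)%N & ~~ bit s x.
Proof.
split=> [h i _ le|h].
  apply: contrapT => hn; case/nonfaces_windowsP: h; exists i => // x hx.
  by apply: contraT => nb; case: hn; exists x.
apply/nonfaces_windowsP => -[i le hb]; have [x hx] := h i isT le.
by rewrite hb.
Qed.

Lemma marked_subP X s : all (gtn (size w)) X ->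
  (marked X \subset s) <-> (forall x, x \in X -> bit s x).
Proof.
move=> /allP lt; split=> [/fintype.subsetP h x hx|h].
  have [v vw e] := index_ex (lt x hx); rewrite -e bit_index //.
  by apply: h; rewrite inE vw e.
by apply/fintype.subsetP => v; rewrite inE => /andP[vw /h]; rewrite bit_index.
Qed.

Lemma marked_disjointP X s : all (gtn (size w)) X ->
  [disjoint s & marked X] <-> (forall x, x \in X -> ~~ bit s x).
Proof.
move=> /allP lt; split=> [h x hx|h].
  have [v vw e] := index_ex (lt x hx); rewrite -e bit_index //.
  by rewrite (disjointFl h) // inE vw e.
apply/pred0P => v /=; rewrite inE; apply/negbTE/negP => /and3P[vs vw /h].
by rewrite bit_index // vs.
Qed.

Lemma card_marked X : uniq X -> all (gtn (size w)) X -> #|marked X| = size X.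
Proof.
move=> uX /allP lt; have e : marked X =i [seq v <- w | index v w \in X].
  by move=> v; rewrite inE mem_filter andbC.
rewrite (eq_card e) (card_uniqP _) ?filter_uniq //.
rewrite -(size_map (index^~ w)); apply/perm_size/uniq_perm => //.
  rewrite map_inj_in_uniq ?filter_uniq // => u v.
  rewrite !mem_filter => /andP[_ uw] /andP[_ vw] eq_uv.
  by rewrite -(nth_index u uw) eq_uv nth_index.
move=> x; apply/mapP/idP => [[v]|hx]; first by rewrite mem_filter => /andP[? _] ->.
have [v vw ev] := index_ex (lt x hx); exists v => //.
by rewrite mem_filter ev hx.
Qed.

Definition line_label s L := greedy (size w) t (bit s) 0 L.
Definition line_low L := marked (forced t 0 L).

Lemma line_label_ex s : s \notin nonfaces windows -> exists L, line_label s L.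
Proof. by move=> /faceP h; apply: greedy_ex => // i _; apply: h. Qed.

Lemma line_label_face s L : line_label s L -> s \notin nonfaces windows.
Proof. by move=> hL; apply/faceP => i _; apply: greedy_hits hL _. Qed.

Lemma line_label_uniq s L L' : line_label s L -> line_label s L' -> L = L'.
Proof. exact: greedy_uniq. Qed.

Lemma line_label_lt s L : line_label s L -> all (gtn (size w)) L.
Proof. by case/greedy_sorted. Qed.

Lemma line_label_interval s L : line_label s L ->
  forall s', line_label s' L <-> s' \in interval (line_low L) (marked L).
Proof.
move=> hL s'; rewrite inE; have lt := line_label_lt hL.
have lt' := greedy_forced_lt hL.
split=> [/(greedy_interval _ hL)[h1 h2]|/andP[h1 h2]].
  by apply/andP; split; [apply/marked_subP|apply/marked_disjointP].
apply/(greedy_interval _ hL); split; first exact/marked_subP.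
exact/marked_disjointP.
Qed.

Lemma card_line_cut s L : line_label s L -> #|marked L| = size L.
Proof.
move=> hL; apply: card_marked; first exact: greedy_uniq_seq hL.
exact: line_label_lt hL.
Qed.

Lemma line_label_mono s s' L L' : line_label s L -> line_label s' L' -> s \subset s' ->
  (#|marked L| <= #|marked L'|)%N /\
  (#|marked L| = #|marked L'| -> L = L' \/ (sumn L' < sumn L)%N).
Proof.
move=> hL hL' /fintype.subsetP ss'; rewrite (card_line_cut hL) (card_line_cut hL').
apply: (greedy_mono hL hL') => // x.
have [lt|le] := ltnP x (size w); last by rewrite /bit nth_default ?size_map.
by have [v vw <-] := index_ex lt; rewrite !bit_index //; apply: ss'.
Qed.

Lemma sequentially_CM_line : sequentially_CM (monomial_ideal k (nonfaces windows)).
Proof.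
exact: (sequentially_CM_shelling k (@up_closed_nonfaces _ _) line_label_ex line_label_face
  line_label_uniq line_label_interval line_label_mono).
Qed.

(** For [t] or [2 * t] elements all greedy covers have the same size, 1 or 2, so there is a single
    layer. *)
Lemma cohen_macaulay_line : size w = t \/ size w = (2 * t)%N ->
  cohen_macaulay (monomial_ideal k (nonfaces windows)).
Proof.
move=> hsz.
have [c hc] : exists c, forall s L, line_label s L -> #|~: marked L| = c.
  case: hsz => e; [exists (n - 1)%N | exists (n - 2)%N] => s L hL.
    rewrite finset.cardsCs finset.setCK card_ord (card_line_cut hL).
    by rewrite (greedy_size1 t_gt0 e hL).
  rewrite finset.cardsCs finset.setCK card_ord (card_line_cut hL).
  by rewrite (greedy_size2 t_gt0 e hL).
apply: (cohen_macaulay_shelling k (@up_closed_nonfaces _ _) line_label_ex line_label_face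
  line_label_uniq line_label_interval line_label_mono _ hc).
exists finset.set0; apply/faceP => i _ le; exists i; first by lia.
by have [|v vw <-] := @index_ex i; [lia | rewrite bit_index // inE].
Qed.

Lemma marked_cover X : all (gtn (size w)) X ->
  (forall i, (i + t <= size w)%N -> exists2 x, (i <= x < i + t)%N & x \in X) ->
  forall s, s \in nonfaces windows -> ~~ [disjoint s & marked X].
Proof.
move=> lt cover s /nonfaces_windowsP[i le hb]; apply/negP => /(marked_disjointP _ lt) h.
by have [x hx /h] := cover i le; rewrite hb.
Qed.

(** Comparison of covers in terms of positions; [X] is minimal in that each of its points is alone
    in some window. *)
Lemma cohen_macaulay_line_card X X' :
  uniq X -> all (gtn (size w)) X -> uniq X' -> all (gtn (size w)) X' ->
  (forall i, (i + t <= size w)%N -> exists2 x, (i <= x < i + t)%N & x \in X) ->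
  (forall c, c \in X -> exists2 i, (i + t <= size w)%N &
     forall x, (i <= x < i + t)%N -> x \in X -> x = c) ->
  (forall i, (i + t <= size w)%N -> exists2 x, (i <= x < i + t)%N & x \in X') ->
  cohen_macaulay (monomial_ideal k (nonfaces windows)) -> (size X <= size X')%N.
Proof.
move=> uX ltX uX' ltX' cover min cover' CM.
rewrite -(card_marked uX ltX) -(card_marked uX' ltX').
apply: (cohen_macaulay_cover_card _ _ _ _ CM); first exact: up_closed_nonfaces.
- exact: marked_cover.
- move=> v; rewrite inE => /andP[vw /min[i le h]].
  apply/nonfaces_windowsP; exists i => // x hx.
  have [|u uw e] := @index_ex x; first by lia.
  rewrite -e bit_index // !inE uw e /=; case: (boolP (x \in X)) => hX; last by rewrite orbT.
  by rewrite -(nth_index v uw) e (h x hx hX) nth_index // eqxx.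
- exact: marked_cover.
Qed.

(** Every window contains [t.-1], and [[:: 0; t]] is also a minimal cover: the window at 0 misses
    [t], while all others contain [t] and miss 0. *)
Lemma not_cohen_macaulay_short_line : (t < size w < 2 * t)%N ->
  ~ cohen_macaulay (monomial_ideal k (nonfaces windows)).
Proof.
move=> hsz CM; suff : (2 <= 1)%N by [].
apply: (cohen_macaulay_line_card (X := [:: 0%N; t]) (X' := [:: t.-1]) _ _ _ _ _ _ _ CM).
- by rewrite /= inE andbT; lia.
- by rewrite /=; lia.
- by [].
- by rewrite /=; lia.
- move=> i le; have [->|i0] := posnP i; first by exists 0%N; rewrite ?inE //; lia.
  by exists t; rewrite ?inE ?eqxx ?orbT //; lia.
- move=> c; rewrite !inE => /orP[]/eqP->; [exists 0%N | exists 1%N]; try lia.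
    by move=> x hx; rewrite !inE; lia.
  by move=> x hx; rewrite !inE; lia.
- by move=> i le; exists t.-1; rewrite ?inE //; lia.
Qed.

Lemma multiple_in_window a : exists2 x, (a <= x < a + t)%N & (t %| x)%N.
Proof.
exists (a + t.-1 - (a + t.-1) %% t)%N; last by rewrite {1}(divn_eq (a + t.-1) t) addnK dvdn_mull.
have := ltn_pmod (a + t.-1) t_gt0; lia.
Qed.

Lemma multiple_in_window_uniq a x y : (a <= x < a + t)%N -> (a <= y < a + t)%N ->
  (t %| x)%N -> (t %| y)%N -> x = y.
Proof.
move=> hx hy /dvdnP[q ex] /dvdnP[q' ey].
have : q = q' by nia.
by rewrite ex ey => ->.
Qed.

(* Two minimal covers of different sizes: {t - 1, 2t - 1, ...} and
   {0, t, t + 1, 2t + 1, 3t + 1, ...}. *)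
Lemma not_cohen_macaulay_long_line : (1 < t)%N -> (2 * t < size w)%N ->
  ~ cohen_macaulay (monomial_ideal k (nonfaces windows)).
Proof.
move=> t_gt1 hsz CM.
pose inX x := [|| x == 0%N, x == t | (t < x)%N && (t %| x.-1)%N].
pose X := [seq x <- iota 0 (size w) | inX x].
pose X' := [seq x <- iota 0 (size w) | (t %| x.+1)%N].
have XE x : (x \in X) = inX x && (x < size w)%N by rewrite mem_filter mem_iota.
have XE' x : (x \in X') = (t %| x.+1)%N && (x < size w)%N by rewrite mem_filter mem_iota.
have uX : uniq X by rewrite filter_uniq // iota_uniq.
have uX' : uniq X' by rewrite filter_uniq // iota_uniq.
have : (size X <= size X')%N.
  apply: (cohen_macaulay_line_card _ _ _ _ _ _ _ CM) => //.
  - by apply/allP => x; rewrite XE => /andP[].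
  - by apply/allP => x; rewrite XE' => /andP[].
  - move=> i le; have [->|i0] := posnP i; first by exists 0%N; rewrite ?XE /inX /=; lia.
    have [lei|lti] := leqP i t.
      by exists t; rewrite ?XE /inX ?eqxx ?orbT //; lia.
    have [x hx hd] := multiple_in_window i.-1.
    exists x.+1; first by lia.
    by rewrite XE /inX /= hd andbT; lia.
  - move=> c; rewrite XE /inX => /andP[/or3P[/eqP->|/eqP->|/andP[ltc hd]] cN].
    + exists 0%N; first by lia.
      by move=> x hx; rewrite XE /inX; lia.
    + exists 1%N; first by lia.
      by move=> x hx; rewrite XE /inX; lia.
    (* Since [t] is also in [X], the window in which [t.+1] is alone has to start at [t.+1]; it fits
       because [2 * t < size w]. Every later point is alone in the window that ends at it. *)
    + have [ec|nc] := eqVneq c t.+1.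
        exists t.+1; first by lia.
        move=> x hx; rewrite XE /inX => /andP[/or3P[/eqP e|/eqP e|/andP[lx hd']] _]; try lia.
        have := @multiple_in_window_uniq t x.-1 c.-1; rewrite hd hd'; lia.
      have ge : (2 * t < c)%N.
        case/dvdnP: hd => -[|[|q]] eq; [lia|lia|].
        by rewrite !mulSn in eq; lia.
      exists (c.+1 - t)%N; first by lia.
      move=> x hx; rewrite XE /inX => /andP[/or3P[/eqP e|/eqP e|/andP[lx hd']] _]; try lia.
      have := @multiple_in_window_uniq (c - t)%N x.-1 c.-1; rewrite hd hd'; lia.
  - move=> i le; have [x hx hd] := multiple_in_window i.+1.
    exists x.-1; first by lia.
    by rewrite XE' prednK ?hd; lia.
(* An injection of [X'] into [X] that misses [t]: [t.-1] goes to 0, and [j * t - 1] goes to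
   [(j - 1) * t + 1] for j >= 2. So [X] is strictly larger. *)
pose f x := if x == t.-1 then 0%N else (x - t + 2)%N.
have ge x : x \in X' -> x != t.-1 -> (2 * t <= x.+1)%N.
  rewrite XE' => /andP[/dvdnP[[|[|q]] eq] _] /eqP ne; [lia|lia|].
  by rewrite !mulSn in eq; lia.
suff : (size (t :: map f X') <= size X)%N by rewrite /= size_map; lia.
apply: uniq_leq_size => [|y].
  rewrite cons_uniq; apply/andP; split.
    apply/mapP => -[x hx]; rewrite /f; case: eqP => [_|/eqP ne]; first by lia.
    by have := ge x hx ne; lia.
  rewrite map_inj_in_uniq // => x y hx hy; rewrite /f.
  case: (eqVneq x t.-1) => [->|nx]; case: (eqVneq y t.-1) => [->|ny] //; try lia.
  by have := ge x hx nx; have := ge y hy ny; lia.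
rewrite inE => /orP[/eqP->|/mapP[x hx ->]].
  by rewrite XE /inX eqxx orbT; lia.
rewrite XE /inX /f; case: (eqVneq x t.-1) => [_|nx]; first by rewrite eqxx; lia.
have h := ge x hx nx; move: hx; rewrite XE' => /andP[hd hN].
apply/andP; split; last by lia.
apply/or3P; apply: Or33; apply/andP; split; first by lia.
have -> : (x - t + 2).-1 = (x.+1 - t)%N by lia.
by rewrite dvdn_sub.
Qed.
End Line.

(** * Two chains with common ends *)

Section LastOutside.
Variables (T : finType) (q : seq T).
Implicit Types (s : {set T}).

Definition later y : {set T} := [set x | (x \in q) && (index y q < index x q)%N].

Definition last_outside s y : bool := [&& y \in q, y \notin s & later y \subset s].

Lemma last_outside_ex s : ~~ all (mem s) q -> exists y, last_outside s y.
Proof.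
move=> /allPn[y0 y0q y0s].
have P0 : [pred y in q | y \notin s] y0 by rewrite /= y0q.
case: (arg_maxnP (index^~ q) P0) => y /= /andP[yq ys] ymax; exists y.
rewrite /last_outside yq ys; apply/fintype.subsetP => x; rewrite inE => /andP[xq lt].
apply: contraT => xs; have := ymax x; rewrite /= xq xs => /(_ isT).
by rewrite /geq leqNgt lt.
Qed.

Lemma last_outside_mono s s' y y' : last_outside s y -> last_outside s' y' -> s \subset s' ->
  y = y' \/ (index y' q < index y q)%N.
Proof.
move=> /and3P[yq _ hy] /and3P[y'q y's' _] ss'.
case: (ltngtP (index y q) (index y' q)) => [lt|_|eq]; [|by right|left].
  case/negP: y's'; apply: (fintype.subsetP ss'); apply: (fintype.subsetP hy).
  by rewrite inE y'q.
by rewrite -(nth_index y yq) eq nth_index.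
Qed.

Lemma last_outside_uniq s y y' : last_outside s y -> last_outside s y' -> y = y'.
Proof.
move=> h h'; have := last_outside_mono h' h (subxx _).
by case: (last_outside_mono h h' (subxx _)) => // lt [//|]; lia.
Qed.

Lemma last_outside_notall s y : last_outside s y -> ~~ all (mem s) q.
Proof. by move=> /and3P[yq ys _]; apply/allPn; exists y. Qed.
End LastOutside.

Section TwoChains.
Variables (k : fieldType) (n : nat) (a b : 'I_n) (q1 q2 : seq 'I_n).
Hypotheses (uniq1 : uniq (a :: rcons q1 b)) (uniq2 : uniq (a :: rcons q2 b)).
Hypothesis disj : forall x, ~ (x \in q1 /\ x \in q2).
Implicit Types (s : {set 'I_n}).

Definition two_chains := [:: a :: rcons q1 b; a :: rcons q2 b].

Lemma two_chains_ends : [/\ a != b, a \notin q1, a \notin q2, b \notin q1 & b \notin q2].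
Proof.
move: uniq1 uniq2; rewrite /= !mem_rcons !inE !negb_or !rcons_uniq.
by move=> /and3P[/andP[-> ->] -> _] /and3P[/andP[_ ->] -> _].
Qed.

Lemma nonfaces_two_chainsE s : (s \in nonfaces two_chains) =
  [&& a \in s, b \in s & all (mem s) q1 || all (mem s) q2].
Proof.
rewrite inE /= !all_rcons orbF /=.
by case: (a \in s); case: (b \in s).
Qed.

(** The label is a missing end, [a] taking precedence over [b], or, when both ends are present, the
    last gap of each interior. The precedence is what makes labels unique. *)
Definition chain_label s (l : 'I_n + 'I_n * 'I_n) : bool :=
  match l with
  | inl v => (v == a) && (a \notin s) || [&& v == b, b \notin s & a \in s]
  | inr (y, z) => [&& a \in s, b \in s, last_outside q1 s y & last_outside q2 s z]
  end.

Definition chain_low (l : 'I_n + 'I_n * 'I_n) : {set 'I_n} :=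
  match l with
  | inl v => if v == b then [set a]%SET else finset.set0
  | inr (y, z) => [set a; b]%SET :|: later q1 y :|: later q2 z
  end.

Definition chain_cut (l : 'I_n + 'I_n * 'I_n) : {set 'I_n} :=
  match l with
  | inl v => [set v]%SET
  | inr (y, z) => [set y; z]%SET
  end.

(** A face without [a] can grow into one that contains [a] but not [b], so the class of [a] is the
    heavier; for pairs, growth moves the last gaps towards the front. *)
Definition chain_weight (l : 'I_n + 'I_n * 'I_n) : nat :=
  match l with
  | inl v => v == a
  | inr (y, z) => (index y q1 + index z q2)%N
  end.

Lemma chain_label_ex s : s \notin nonfaces two_chains -> exists l, chain_label s l.
Proof.
rewrite nonfaces_two_chainsE.
have [sa|sa] := boolP (a \in s); last by exists (inl a); rewrite /= eqxx sa.
have [sb|sb] := boolP (b \in s); last by exists (inl b); rewrite /= eqxx sa sb orbT.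
rewrite /= negb_or => /andP[/last_outside_ex[y hy] /last_outside_ex[z hz]].
by exists (inr (y, z)); rewrite /= sa sb hy.
Qed.

Lemma chain_label_face s l : chain_label s l -> s \notin nonfaces two_chains.
Proof.
rewrite nonfaces_two_chainsE; case: l => [v|[y z]] /=.
  by case: (a \in s); case: (b \in s); rewrite ?andbF.
by move=> /and4P[-> -> /last_outside_notall/negbTE-> /last_outside_notall/negbTE->].
Qed.

Lemma chain_label_uniq s l l' : chain_label s l -> chain_label s l' -> l = l'.
Proof.
case: l l' => [v|[y z]] [v'|[y' z']] /=.
- case: (a \in s); rewrite /= ?andbF ?andbT ?orbF /=.
    by move=> /andP[/eqP-> _] /andP[/eqP-> _].
  by move=> /eqP-> /eqP->.
- by case: (a \in s); case: (b \in s); rewrite ?andbF.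
- by case: (a \in s); case: (b \in s); rewrite ?andbF.
move=> /and4P[_ _ hy hz] /and4P[_ _ hy' hz'].
by rewrite (last_outside_uniq hy hy') (last_outside_uniq hz hz').
Qed.

Lemma chain_label_interval s l : chain_label s l ->
  forall s', chain_label s' l <-> s' \in interval (chain_low l) (chain_cut l).
Proof.
have [ab _ _ _ _] := two_chains_ends.
move=> hl s'; apply: iff_sym; rewrite inE disjoint_sym; case: l hl => [v|[y z]] /= hl.
  rewrite finset.disjoints1; case/orP: hl => [/andP[/eqP-> _]|/and3P[/eqP-> _ _]].
    by rewrite (negbTE ab) finset.sub0set eqxx /= orbF.
  by rewrite eqxx (eq_sym b) (negbTE ab) finset.sub1set /= andbC.
case/and4P: hl => _ _ /and3P[yq _ _] /and3P[zq _ _].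
rewrite disjoint_setUl !finset.disjoints1 !finset.subUset !finset.sub1set /last_outside yq zq /=.
by case: (a \in s'); case: (b \in s'); case: (y \in s'); case: (z \in s');
  case: (_ \subset s'); case: (_ \subset s').
Qed.

Lemma chain_label_mono s s' l l' : chain_label s l -> chain_label s' l' -> s \subset s' ->
  (#|chain_cut l| <= #|chain_cut l'|)%N /\
  (#|chain_cut l| = #|chain_cut l'| -> l = l' \/ (chain_weight l' < chain_weight l)%N).
Proof.
have [ab _ _ _ _] := two_chains_ends.
have card2 y z s0 : chain_label s0 (inr (y, z)) -> #|[set y; z]%SET| = 2%N.
  move=> /and4P[_ _ /and3P[yq _ _] /and3P[zq _ _]]; rewrite finset.cards2.
  by case: eqP => // e; case: (@disj y); rewrite {2}e.
move=> hl hl' /[dup] ss' /fintype.subsetP sub; case: l l' hl hl' => [v|[y z]] [v'|[y' z']] hl hl'.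
- rewrite /= !finset.cards1; split=> // _; move: hl hl' => /=.
  have [sa|sa] := boolP (a \in s).
    rewrite (sub _ sa) !andbF /= => /andP[/eqP-> _] /andP[/eqP-> _]; by left.
  rewrite !andbF orbF andbT => /eqP-> /orP[/andP[/eqP-> _]|/and3P[/eqP-> _ _]]; first by left.
  by right; rewrite eqxx eq_sym (negbTE ab).
- by rewrite /= (card2 _ _ _ hl') finset.cards1.
- case/and4P: hl => /sub sa /sub sb _ _; move: hl' => /=.
  by rewrite sa sb !andbF.
- rewrite /= (card2 _ _ _ hl) (card2 _ _ _ hl'); split=> // _.
  case/and4P: hl => _ _ hy hz; case/and4P: hl' => _ _ hy' hz'.
  case: (last_outside_mono hy hy' ss') => [<-|lt1]; case: (last_outside_mono hz hz' ss') => [<-|lt2];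
    [by left|right..]; rewrite /=.
  - by rewrite ltn_add2l.
  - by rewrite ltn_add2r.
  - by rewrite -addSn leq_add // ltnW.
Qed.

Lemma sequentially_CM_two_chains : sequentially_CM (monomial_ideal k (nonfaces two_chains)).
Proof.
exact: (sequentially_CM_shelling k (@up_closed_nonfaces _ _) chain_label_ex chain_label_face
  chain_label_uniq chain_label_interval chain_label_mono).
Qed.

(* The covers {a} and {y, z}, with y and z inside the two chains, are minimal. *)
Lemma not_cohen_macaulay_two_chains y z : y \in q1 -> z \in q2 ->
  ~ cohen_macaulay (monomial_ideal k (nonfaces two_chains)).
Proof.
move=> yq zq CM; have [ab aq1 aq2 bq1 bq2] := two_chains_ends.
have yq2 : y \notin q2 by apply/negP => h; apply: (disj (x := y)).
have zq1 : z \notin q1 by apply/negP => h; apply: (disj (x := z)).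
have yz : y != z by apply: contraNneq yq2 => ->.
have neq (u v : 'I_n) (q : seq 'I_n) : u \in q -> v \notin q -> v != u by move=> hu; apply: contraNneq => ->.
suff : (#|[set y; z]%SET| <= #|[set a]%SET|)%N by rewrite finset.cards2 finset.cards1 yz.
apply: (cohen_macaulay_cover_card _ _ _ _ CM); first exact: up_closed_nonfaces.
- move=> s; rewrite nonfaces_two_chainsE disjoint_sym disjoint_setUl !finset.disjoints1.
  case/and3P => _ _ /orP[] /allP h.
    by have /= -> := h y yq.
  by have /= -> := h z zq; rewrite andbF.
- move=> v hv; rewrite nonfaces_two_chainsE !inE !negb_or.
  rewrite (neq y a q1) // (neq z a q2) // (neq y b q1) // (neq z b q2) // !orbT /=.
  have inside q : (forall x, x \in q -> x != v -> x \notin [set y; z]%SET) ->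
      all (mem (v |: ~: [set y; z]%SET)) q.
    by move=> h; apply/allP => x hx; rewrite !inE; case: (eqVneq x v) => //= /(h x hx); rewrite !inE.
  move: hv; rewrite !inE => /orP[]/eqP ev; apply/orP; [left|right].
    apply: inside => x hx; rewrite ev => xy; rewrite !inE (negbTE xy) /=.
    by rewrite eq_sym; exact: neq zq1.
  apply: inside => x hx; rewrite ev => xz; rewrite !inE (negbTE xz) orbF.
  by rewrite eq_sym; exact: neq yq2.
- move=> s; rewrite nonfaces_two_chainsE disjoint_sym finset.disjoints1.
  by case/and3P => ->.
Qed.
End TwoChains.

(** * Paths in posets *)

Section Paths.
Variables (disp : Order.disp_t) (P : finPOrderType disp).
Implicit Types (c d : seq P).

Lemma saturated_sorted c : saturated_chain c -> sorted (<%O) c.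
Proof. by apply: sub_sorted => x y /andP[]. Qed.

Lemma saturated_uniq c : saturated_chain c -> uniq c.
Proof. by move=> /saturated_sorted; apply: lt_sorted_uniq. Qed.

Lemma saturated_eq c d : saturated_chain c -> saturated_chain d ->
  {subset c <= d} -> (size d <= size c)%N -> c = d.
Proof.
move=> hc hd sub le; apply: lt_sorted_eq; try exact: saturated_sorted.
by case: (uniq_min_size (saturated_uniq hc) sub le).
Qed.

(** A longest saturated chain containing [c] is maximal. *)
Lemma maximal_saturated_ex c : saturated_chain c ->
  exists2 d, maximal_saturated_chain d & {subset c <= d}.
Proof.
move=> hc.
pose Q v := `[< exists d, [/\ saturated_chain d, {subset c <= d} & size d = v] >].
have exQ : exists v, Q v by exists (size c); apply/asboolP; exists c; split.
have ubQ v : Q v -> (v <= #|P|)%N.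
  move=> /asboolP[d [hd _ <-]]; rewrite cardE.
  by apply: uniq_leq_size (saturated_uniq hd) _ => x _; rewrite mem_enum.
case: (ex_maxnP exQ ubQ) => v /asboolP[d [hd sub ev]] vmax.
exists d => //; split=> // d' hd' sub'; apply/esym; apply: saturated_eq => //.
rewrite ev; apply: vmax; apply/asboolP; exists d'; split=> // x hx.
by apply: sub'; apply: sub.
Qed.

(** No element of [c] fits between an element and its cover, so consecutive elements of the smaller
    chain are consecutive in [c]. *)
Lemma saturated_infix x d c : saturated_chain (x :: d) -> saturated_chain c ->
  {subset x :: d <= c} -> x :: d = take (size d).+1 (drop (index x c) c).
Proof.
move=> + hc; elim: d x => [|y d IH] x hd sub.
  have xc : x \in c by apply: sub; rewrite inE.
  by rewrite (drop_nth x) ?index_mem // nth_index //= take0.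
have xc : x \in c by apply: sub; rewrite inE eqxx.
have yc : y \in c by apply: sub; rewrite !inE eqxx orbT.
move: hd => /= /andP[/andP[lt_xy /forallP cov] hd].
have hlt := saturated_sorted hc.
have lt_nth i j : (i < j)%N -> (j < size c)%N -> (nth x c i < nth x c j)%O.
  move=> ij jc; apply: (sorted_ltn_nth lt_trans x hlt) => //.
  by rewrite inE (ltn_trans ij).
have ix : (index x c < size c)%N by rewrite index_mem.
have iy : (index y c < size c)%N by rewrite index_mem.
have eiy : index y c = (index x c).+1.
  case: (ltngtP (index y c) (index x c).+1) => // [lt|gt].
    have : (y <= x)%O.
      move: lt; rewrite ltnS leq_eqVlt => /orP[/eqP e|lt].
        by rewrite -(nth_index x yc) e nth_index.
      by have := lt_nth _ _ lt ix; rewrite !nth_index // => /ltW.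
    by move=> /(lt_le_trans lt_xy); rewrite ltxx.
  have := lt_nth _ _ (ltnSn (index x c)) (ltn_trans gt iy); rewrite nth_index // => lt1.
  have := lt_nth _ _ gt iy; rewrite nth_index // => lt2.
  by have := cov (nth x c (index x c).+1); rewrite lt1 lt2.
have /IH -> // : saturated_chain (y :: d) by [].
  by rewrite (drop_nth x ix) nth_index //= eiy.
by move=> z hz; apply: sub; rewrite inE hz orbT.
Qed.

Variable k : fieldType.
Local Notation ranks := (map (@enum_rank P)).

Lemma path_monomialE c : uniq c ->
  path_monomial k c = 'X_[mesym1 [set i in ranks c]%SET].
Proof.
move=> uc; rewrite /path_monomial mprodXE; congr 'X_[_].
apply/mnmP => j; rewrite mnm_sumE mnmE inE.
have ur : uniq (ranks c) by rewrite map_inj_uniq //; exact: enum_rank_inj.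
rewrite -(count_uniq_mem _ ur) count_map -sum1_count [RHS]big_mkcond /=.
by apply: eq_bigr => x _; rewrite mnm1E; case: eqP.
Qed.

Lemma path_idealE t (gens : seq (seq 'I_#|P|)) :
  (forall g, g \in gens -> exists c, [/\ saturated_chain c, size c = t & g = ranks c]) ->
  (forall c, saturated_chain c -> size c = t -> ranks c \in gens) ->
  @path_ideal _ P k t = monomial_ideal k (nonfaces gens).
Proof.
move=> h1 h2; have up := @up_closed_nonfaces _ gens.
apply/seteqP; split.
  apply: ideal_generated_sub; first exact: monomial_ideal_is_ideal.
  move=> _ [c [hc sz ->]]; rewrite path_monomialE ?saturated_uniq //.
  apply/monomial_idealX; rewrite supp_mesym1 inE; apply/hasP; exists (ranks c).
    exact: h2.
  by apply/allP => i hi /=; rewrite inE.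
apply: monomial_ideal_sub; first exact: ideal_generated_ideal.
move=> m; rewrite inE => /hasP[g /h1[c [hc sz ->]] /allP hm].
have le : (mesym1 [set i in ranks c]%SET <= m)%MM.
  by rewrite mesym1_le; apply/fintype.subsetP => i; rewrite inE => /hm.
rewrite -(submK le) mpolyXD -path_monomialE ?saturated_uniq //.
apply: (idealM _ (ideal_generated_ideal _)).
by apply: sub_gen_smallest; exists c.
Qed.

(** A path extends to a maximal chain of at least [t] elements, which can only be [c], and is then a
    window of [c]. *)
Lemma path_ideal_line t c : (0 < t)%N -> maximal_saturated_chain c ->
  (forall c', maximal_saturated_chain c' -> c' = c \/ (size c' < t)%N) ->
  @path_ideal _ P k t = monomial_ideal k (nonfaces (windows (ranks c) t)).
Proof.
move=> t0 [hc _] hmax; apply: path_idealE => [g /mapP[i]|d hd sz].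
  rewrite mem_filter size_map => /andP[le _] ->; exists (take t (drop i c)); split.
  - by apply: take_sorted; apply: drop_sorted.
  - by rewrite size_takel // size_drop -[leqLHS](addKn i) leq_sub2r.
  - by rewrite map_take map_drop.
have [c' hc' sub] := maximal_saturated_ex hd.
have dc' : (t <= size c')%N by rewrite -sz; apply: uniq_leq_size => //; apply: saturated_uniq.
have ec : c' = c by case: (hmax c' hc') => // lt; move: dc'; rewrite leqNgt lt.
rewrite ec in sub; case: d hd sz sub => [|x d] hd sz sub; first by rewrite -sz in t0.
have e := saturated_infix hd hc sub; rewrite /= in sz.
have le : (index x c + t <= size c)%N.
  have := congr1 size e; rewrite /= size_take_min size_drop sz => /esym/minn_idPl.
  by rewrite leq_subRL // ltnW // index_mem; apply: sub; rewrite inE eqxx.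
apply/mapP; exists (index x c).
  by rewrite mem_filter size_map le mem_iota ltnS (leq_trans (leq_addr t _) le).
by rewrite e sz map_take map_drop.
Qed.

Lemma path_ideal_two_chains (a b : P) (s1 s2 : seq P) :
  let c1 := a :: rcons s1 b in let c2 := a :: rcons s2 b in
  size c1 = size c2 ->
  (forall c, maximal_saturated_chain c <-> c = c1 \/ c = c2) ->
  @path_ideal _ P k (size c1) = monomial_ideal k
    (nonfaces (two_chains (enum_rank a) (enum_rank b) (ranks s1) (ranks s2))).
Proof.
move=> c1 c2 esz hmax.
have [hc1 _] : maximal_saturated_chain c1 by apply/hmax; left.
have [hc2 _] : maximal_saturated_chain c2 by apply/hmax; right.
rewrite /two_chains -!map_rcons -!map_cons.
apply: path_idealE => [g|d hd sz].
  by rewrite !inE => /orP[]/eqP->; [exists c1 | exists c2].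
have [c' /[dup] /hmax hc' [satc' _] sub] := maximal_saturated_ex hd.
suff -> : d = c' by rewrite !inE; case: hc' => ->; rewrite eqxx ?orbT.
by apply: saturated_eq => //; case: hc' => ->; rewrite sz // esz.
Qed.

(** Serves case (i), with [c] the longer chain, and also the two-element chain, where the two
    maximal chains coincide. *)
Lemma line_case t c : (1 < t)%N -> maximal_saturated_chain c ->
  (forall c', maximal_saturated_chain c' -> c' = c \/ (size c' < t)%N) ->
  sequentially_CM (@path_ideal _ P k t) /\
  ((t <= size c)%N ->
   cohen_macaulay (@path_ideal _ P k t) <-> t = size c \/ (2 * t)%N = size c).
Proof.
move=> t1 hc hmax; have t0 := ltnW t1.
have ur : uniq (ranks c).
  rewrite map_inj_uniq; last exact: enum_rank_inj.
  by apply: saturated_uniq; case: hc.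
rewrite (path_ideal_line t0 hc hmax); split; first exact: sequentially_CM_line.
move=> le; split=> [CM|h]; last first.
  by apply: cohen_macaulay_line => //; rewrite size_map; case: h => ->; [left|right].
have [//|nt] := eqVneq t (size c); first by left.
have [//|n2t] := eqVneq (2 * t)%N (size c); first by right.
case: (ltnP (2 * t) (size c)) => [lt|ge].
  by case: (not_cohen_macaulay_long_line _ _ _ _ CM); rewrite ?size_map.
by case: (not_cohen_macaulay_short_line _ _ _ CM); rewrite // size_map !ltn_neqAle nt le eq_sym n2t.
Qed.
End Paths.

Local Close Scope ring_scope.
Local Close Scope classical_set_scope.

(** The criterion in case (i) is stated for [t] up to the larger length: beyond it there are no
    paths, the path ideal is zero, and the polynomial ring itself is Cohen-Macaulay. *)
Theorem corollary4p13 (disp : Order.disp_t) (P : finPOrderType disp)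
    (k : fieldType) (m r t : nat)
    (hm : 2 <= m) (hr : 2 <= r) (ht : 2 <= t) (hP : @cycle_poset disp P m r) :
  ((~ @graded_poset disp P /\ minn r m < t) \/
   (@graded_poset disp P /\ t = m) ->
     sequentially_CM (@path_ideal disp P k t)) /\
  (~ @graded_poset disp P -> minn r m < t -> t <= maxn r m ->
     (cohen_macaulay (@path_ideal disp P k t) <->
        t = maxn r m \/ 2 * t = maxn r m)) /\
  (@graded_poset disp P -> t = m ->
     (cohen_macaulay (@path_ideal disp P k t) <-> t = 2) /\
     (t = 2 <-> @two_element_chain disp P)).
Proof.
case: hP => a [b [s1 [s2 [[sz1 sz2] hmax hdisj hcov]]]].
set c1 := a :: rcons s1 b in sz1 hmax hcov; set c2 := a :: rcons s2 b in sz2 hmax hcov.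
have max1 : maximal_saturated_chain c1 by apply/hmax; left.
have max2 : maximal_saturated_chain c2 by apply/hmax; right.
have gradedP : @graded_poset disp P <-> m = r.
  split=> [h|e c c']; first by rewrite -sz1 -sz2; apply: h.
  by move=> /hmax[] -> /hmax[] ->; rewrite ?sz1 ?sz2 ?e.
have nongraded : m <> r -> minn r m < t ->
    sequentially_CM (@path_ideal disp P k t) /\
    (t <= maxn r m -> cohen_macaulay (@path_ideal disp P k t) <->
       t = maxn r m \/ 2 * t = maxn r m).
  move=> /eqP; rewrite neq_ltn => /orP[] lt.
    rewrite (minn_idPr (ltnW lt)) (maxn_idPl (ltnW lt)) -sz2 => lt_t.
    apply: line_case => // c /hmax[]->; [right|by left].
    by rewrite sz1.
  rewrite (minn_idPl (ltnW lt)) (maxn_idPr (ltnW lt)) -sz1 => lt_t.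
  apply: line_case => // c /hmax[]->; [by left|right].
  by rewrite sz2.
have graded : m = r -> t = m ->
    [/\ sequentially_CM (@path_ideal disp P k t),
        cohen_macaulay (@path_ideal disp P k t) <-> t = 2 & t = 2 <-> @two_element_chain disp P].
  move=> emr etm; have satc1 := proj1 max1.
  have nil12 : t = 2 -> s1 = [::] /\ s2 = [::].
    move=> t2; split; apply/size0nil.
      by move: sz1; rewrite /c1 /= size_rcons -etm t2 => -[].
    by move: sz2; rewrite /c2 /= size_rcons -emr -etm t2 => -[].
  have two : t = 2 <-> @two_element_chain disp P.
    split=> [t2|[x [y [lt_xy xyT]]]].
      have [s1nil s2nil] := nil12 t2.
      exists a, b; split.
        by have := saturated_sorted satc1; rewrite /c1 s1nil /= andbT.
      move=> x; have [d /hmax hd sub] := @maximal_saturated_ex _ P [:: x] isT.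
      have : x \in d by apply: sub; rewrite inE.
      by case: hd => ->; rewrite /c1 /c2 ?s1nil ?s2nil !inE => /orP[]/eqP->; [left|right|left|right].
    apply/eqP; rewrite eqn_leq ht andbT etm -sz1.
    apply: (@uniq_leq_size _ c1 [:: x; y]); first exact: saturated_uniq.
    by move=> z _; case: (xyT z) => ->; rewrite !inE eqxx ?orbT.
  (* For [t = 2] both interiors are empty and the poset is a line of [t] elements; otherwise both
     are nonempty and supply the points of a minimal cover of size two. *)
  have [t2|t2] := eqVneq t 2.
    have ec : c2 = c1.
      have [s1nil s2nil] := nil12 t2.
      by rewrite /c1 /c2 s1nil s2nil.
    have [|SCM CM] := @line_case disp P k t c1 ht max1.
      by move=> c /hmax[]->; left; rewrite ?ec.
    split=> //; split=> // _; apply/CM; first by rewrite sz1 etm.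
    by left; rewrite sz1.
  have esz : size c1 = size c2 by rewrite sz1 sz2.
  have eI := path_ideal_two_chains k esz hmax.
  have et : t = size c1 by rewrite sz1.
  have disj x : ~ (x \in [seq enum_rank i | i <- s1] /\ x \in [seq enum_rank i | i <- s2]).
    move=> [/mapP[u us1 ->] /mapP[v vs2 /enum_rank_inj e]].
    by apply: (hdisj u); split=> //; rewrite e.
  have u1 : uniq (enum_rank a :: rcons [seq enum_rank i | i <- s1] (enum_rank b)).
    rewrite -map_rcons -map_cons map_inj_uniq; last exact: enum_rank_inj.
    exact: saturated_uniq.
  have u2 : uniq (enum_rank a :: rcons [seq enum_rank i | i <- s2] (enum_rank b)).
    rewrite -map_rcons -map_cons map_inj_uniq; last exact: enum_rank_inj.
    by apply: saturated_uniq; case: max2.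
  rewrite et eI -et; split=> //; first exact: sequentially_CM_two_chains.
  split=> [CM|e]; last by rewrite e in t2.
  have [y ys1] : exists y, y \in s1.
    move: sz1 t2; rewrite /c1 /= size_rcons -etm; case: (s1) => [<-//|y s _ _].
    by exists y; rewrite inE eqxx.
  have [z zs2] : exists z, z \in s2.
    move: sz2 t2; rewrite /c2 /= size_rcons -emr -etm; case: (s2) => [<-//|z s _ _].
    by exists z; rewrite inE eqxx.
  case: (not_cohen_macaulay_two_chains u1 u2 disj (map_f _ ys1) (map_f _ zs2) CM).
split; [|split].
- by case=> [[/gradedP hn /(nongraded hn)[]]|[/gradedP hg /(graded hg)[]]].
- by move=> /gradedP hn /(nongraded hn)[].
- by move=> /gradedP hg /(graded hg)[].
Qed.
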